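(* Let $K$ be a field. Any special multiserial $K$-algebra is a multiserial algebra.
   Context: A finite dimensional $K$-algebra $A$ is special multiserial if $A$ is Morita equivalent to a quotient $KQ/I$ of a path algebra $KQ$ of a (finite) quiver $Q$ by an admissible ideal $I$ such that the following condition (M) holds: for every arrow $a$ in $Q$ there is at most one arrow $b$ in $Q$ such that $ab\notin I$ and at most one arrow $c$ in $Q$ such that $ca\notin I$. Here $ab$ denotes the path consisting of $a$ followed by $b$ (and $ab=0$ in $KQ$ if the end vertex of $a$ is not the start vertex of $b$). A left or right $A$-module $M$ is multiserial if $\operatorname{rad}(M)$ can be written as a sum of uniserial modules $U_1,\dots,U_l$ such that, if $i\neq j$, then $U_i\cap U_j$ is either $(0)$ or a simple module. A module is uniserial if its submodules are totally ordered by inclusion. The algebra $A$ is multiserial if $A$ is multiserial both as a right $A$-module and as a left $A$-module. *)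

(* Defs.v *)
(* MathComp, with classical_sets for Prop-valued subsets (set T) and
   multinomials.monalg for free modules {malg K[T]}. *)
From HB Require Import structures.
From mathcomp Require Import all_boot all_order all_algebra all_field.
From mathcomp Require Import classical_sets finmap.
From mathcomp.multinomials Require Import monalg.

Set Implicit Arguments.
Unset Strict Implicit.
Unset Printing Implicit Defensive.

Import GRing.Theory.

Local Open Scope ring_scope.
Local Open Scope classical_set_scope.

Section Modules.
Variables (R : pzRingType) (M : lmodType R).

Definition submodule (N : set M) : Prop :=
  N 0 /\ forall (a : R) (x y : M), N x -> N y -> N (a *: x + y).

Definition maximal_submodule (N : set M) : Prop :=
  [/\ submodule N, N <> setT &
      forall N' : set M, submodule N' -> N `<=` N' -> N' = N \/ N' = setT].

Definition radical : set M :=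
  [set x | forall N : set M, maximal_submodule N -> N x].

(* For a submodule U of M, the submodules of the module U are the submodules
   of M contained in U; uniserial and simple are stated accordingly. *)
Definition uniserial (U : set M) : Prop :=
  submodule U /\
  forall N N' : set M, submodule N -> submodule N' ->
    N `<=` U -> N' `<=` U -> N `<=` N' \/ N' `<=` N.

Definition simple_submodule (S : set M) : Prop :=
  [/\ submodule S, S <> [set 0] &
      forall N : set M, submodule N -> N `<=` S -> N = [set 0] \/ N = S].

Definition sum_of_submodules (l : nat) (U : 'I_l -> set M) : set M :=
  [set x | exists2 u : 'I_l -> M, (forall i, U i (u i)) & x = \sum_i u i].

Definition multiserial_module : Prop :=
  exists (l : nat) (U : 'I_l -> set M),
    [/\ forall i, uniserial (U i),
        radical = sum_of_submodules U &
        forall i j, i <> j ->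
          U i `&` U j = [set 0] \/ simple_submodule (U i `&` U j)].

End Modules.

(* Right A-modules are left modules over the converse ring A^c. *)
Definition multiserial_algebra (A : pzRingType) : Prop :=
  multiserial_module (A^c)^o /\ multiserial_module A^o.

Section Ideals.
Variable R : pzRingType.

Definition ideal (I : set R) : Prop :=
  [/\ I 0, forall x y, I x -> I y -> I (x + y) &
      forall a x, I x -> I (a * x) /\ I (x * a)].

Definition ideal_gen (S : set R) : set R :=
  [set x | forall I : set R, ideal I -> S `<=` I -> I x].

Definition ideal_mul (I J : set R) : set R :=
  ideal_gen [set z | exists x y, [/\ I x, J y & z = x * y]].

Definition ideal_exp (I : set R) (n : nat) : set R :=
  iter n (ideal_mul I) setT.

End Ideals.

(* Algebras in MathComp are nonzero rings, whence the nonempty vertex set. *)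
Record quiver := Quiver {
  vertex : finType;
  arrow : finType;
  source : arrow -> vertex;
  target : arrow -> vertex;
  vertex_gt0 : (0 < #|vertex|)%N
}.

Section Paths.
Variable Q : quiver.

Fixpoint composable (v : vertex Q) (s : seq (arrow Q)) : bool :=
  if s is a :: s' then (source a == v) && composable (target a) s' else true.

(* A path is its start vertex together with its arrows, in the order in which
   they are followed; the trivial path at v is (v, [::]). *)
Definition qpath := {p : vertex Q * seq (arrow Q) | composable p.1 p.2}.

HB.instance Definition _ := SubChoice.on qpath.

Definition path_start (p : qpath) : vertex Q := (val p).1.

Definition path_arrows (p : qpath) : seq (arrow Q) := (val p).2.

Definition path_end (p : qpath) : vertex Q :=
  last (path_start p) [seq target a | a <- path_arrows p].

Definition trivial_path (v : vertex Q) : qpath :=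
  @exist _ (fun p => composable p.1 p.2) (v, [::]) isT.

Lemma composable1 (a : arrow Q) : composable (source a) [:: a].
Proof. by rewrite /= eqxx. Qed.

Definition arrow_path (a : arrow Q) : qpath :=
  @exist _ (fun p => composable p.1 p.2) (source a, [:: a]) (composable1 a).

Lemma composable_cat v s t :
  composable v (s ++ t) =
  composable v s && composable (last v [seq target a | a <- s]) t.
Proof. by elim: s v => //= a s IHs v; rewrite IHs andbA. Qed.

(* p followed by q, when the end of p is the start of q. *)
Definition path_cat (p q : qpath) : option qpath :=
  if path_end p == path_start q
  then (insub (path_start p, path_arrows p ++ path_arrows q) : option qpath) else None.

Lemma path_catP p q : path_end p = path_start q ->
  exists r, [/\ path_cat p q = Some r, path_start r = path_start p,
    path_end r = path_end q & path_arrows r = path_arrows p ++ path_arrows q].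
Proof.
move=> epq; rewrite /path_cat epq eqxx.
have h : composable (path_start p) (path_arrows p ++ path_arrows q).
  rewrite composable_cat -/(path_end p) epq.
  by rewrite (valP p : composable _ _) (valP q : composable _ _).
exists (Sub (path_start p, path_arrows p ++ path_arrows q) h).
split=> //; first by rewrite insubT.
by rewrite /path_end /path_start /path_arrows /= map_cat last_cat
           -/(path_end p) epq.
Qed.

Lemma path_catN p q : path_end p <> path_start q -> path_cat p q = None.
Proof. by move/eqP/negbTE=> npq; rewrite /path_cat npq. Qed.

Lemma qpath_inj p q : path_start p = path_start q ->
  path_arrows p = path_arrows q -> p = q.
Proof.
case: p q => [[v s] ps] [[w t] pt]; rewrite /path_start /path_arrows /=.
by move=> e1 e2; apply: val_inj; rewrite /= e1 e2.
Qed.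

Lemma path_catA p q r :
  obind (path_cat p) (path_cat q r) = obind (path_cat^~ r) (path_cat p q).
Proof.
have [epq|npq] := eqVneq (path_end p) (path_start q); last first.
  rewrite (path_catN (elimN eqP npq)) /=.
  have [eqr|nqr] := eqVneq (path_end q) (path_start r); last first.
    by rewrite (path_catN (elimN eqP nqr)).
  have [u [-> us _ _]] := path_catP eqr => /=.
  by rewrite path_catN // us; apply/eqP.
have [u [-> us ue ua]] := path_catP epq => /=.
have [eqr|nqr] := eqVneq (path_end q) (path_start r); last first.
  rewrite (path_catN (elimN eqP nqr)) path_catN // ue; exact/eqP.
have [w [-> ws we wa]] := path_catP eqr => /=.
have [x [-> xs _ xa]] := @path_catP p w (etrans epq (esym ws)).
have [y [-> ys _ ya]] := @path_catP u r (etrans ue eqr).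
congr Some; apply: qpath_inj; first by rewrite xs ys us.
by rewrite xa ya wa ua catA.
Qed.

Lemma trivial_path_cat v p :
  path_cat (trivial_path v) p = if v == path_start p then Some p else None.
Proof.
have [->|nv] := eqVneq; last by rewrite path_catN //; apply/eqP.
have [u [-> us _ ua]] := @path_catP (trivial_path (path_start p)) p erefl.
by congr Some; apply: qpath_inj.
Qed.

Lemma path_cat_trivial p v :
  path_cat p (trivial_path v) = if path_end p == v then Some p else None.
Proof.
have [ev|nv] := eqVneq; last by rewrite path_catN //; apply/eqP.
have [u [-> us _ ua]] := @path_catP p (trivial_path v) ev.
by congr Some; apply: qpath_inj; rewrite // ua cats0.
Qed.

End Paths.

Definition path_algebra (K : fieldType) (Q : quiver) : Type := {malg K[qpath Q]}.

HB.instance Definition _ (K : fieldType) (Q : quiver) :=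
  Choice.on (path_algebra K Q).

Definition path_coef (K : fieldType) (Q : quiver) (p : qpath Q)
  (f : path_algebra K Q) : K := (f : {malg K[qpath Q]})@_p.

Arguments path_coef {K Q} p f.

Definition path_supp (K : fieldType) (Q : quiver) (f : path_algebra K Q) :
  {fset qpath Q} := msupp (f : {malg K[qpath Q]}).

(* The linear structure is that of {malg K[qpath Q]}; the operations are locked
   to keep unification from unfolding them. *)
HB.lock Definition path_algebra_zero (K : fieldType) (Q : quiver) :
  path_algebra K Q := (0 : {malg K[qpath Q]}).

HB.lock Definition path_algebra_opp (K : fieldType) (Q : quiver)
  (f : path_algebra K Q) : path_algebra K Q := - (f : {malg K[qpath Q]}).

HB.lock Definition path_algebra_add (K : fieldType) (Q : quiver)
    (f g : path_algebra K Q) : path_algebra K Q :=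
  (f : {malg K[qpath Q]}) + (g : {malg K[qpath Q]}).

HB.lock Definition path_algebra_scale (K : fieldType) (Q : quiver)
    (a : K) (f : path_algebra K Q) : path_algebra K Q :=
  a *: (f : {malg K[qpath Q]}).

Section PathModule.
Variables (K : fieldType) (Q : quiver).

Local Notation KQ := (path_algebra K Q).

Lemma path_coef_inj (f g : KQ) : (forall p, path_coef p f = path_coef p g) -> f = g.
Proof. by move=> e; apply/malgP. Qed.

Lemma path_coef0_subproof p : path_coef p (path_algebra_zero K Q) = 0.
Proof. by rewrite path_algebra_zero.unlock; apply: mcoeff0. Qed.

Lemma path_coefN_subproof p (f : KQ) :
  path_coef p (path_algebra_opp f) = - path_coef p f.
Proof. by rewrite path_algebra_opp.unlock; apply: mcoeffN. Qed.

Lemma path_coefD_subproof p (f g : KQ) :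
  path_coef p (path_algebra_add f g) = path_coef p f + path_coef p g.
Proof. by rewrite path_algebra_add.unlock; apply: mcoeffD. Qed.

Lemma path_coefZ_subproof p a (f : KQ) :
  path_coef p (path_algebra_scale a f) = a * path_coef p f.
Proof. by rewrite path_algebra_scale.unlock; apply: mcoeffZ. Qed.

Let coefE := (path_coef0_subproof, path_coefN_subproof, path_coefD_subproof,
              path_coefZ_subproof).

Lemma path_addA : associative (@path_algebra_add K Q).
Proof. by move=> f g h; apply: path_coef_inj => p; rewrite !coefE addrA. Qed.

Lemma path_addC : commutative (@path_algebra_add K Q).
Proof. by move=> f g; apply: path_coef_inj => p; rewrite !coefE addrC. Qed.

Lemma path_add0 : left_id (path_algebra_zero K Q) (@path_algebra_add K Q).
Proof. by move=> f; apply: path_coef_inj => p; rewrite !coefE add0r. Qed.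

Lemma path_addN : left_inverse (path_algebra_zero K Q)
  (@path_algebra_opp K Q) (@path_algebra_add K Q).
Proof. by move=> f; apply: path_coef_inj => p; rewrite !coefE addNr. Qed.

HB.instance Definition _ := GRing.isZmodule.Build KQ
  path_addA path_addC path_add0 path_addN.

Lemma path_scaleA a b (f : KQ) :
  path_algebra_scale a (path_algebra_scale b f) = path_algebra_scale (a * b) f.
Proof. by apply: path_coef_inj => p; rewrite !coefE mulrA. Qed.

Lemma path_scale1 : left_id 1 (@path_algebra_scale K Q).
Proof. by move=> f; apply: path_coef_inj => p; rewrite !coefE mul1r. Qed.

Lemma path_scaleDr : right_distributive (@path_algebra_scale K Q) +%R.
Proof.
by move=> a f g; apply: path_coef_inj => p; rewrite !coefE mulrDr.
Qed.

Lemma path_scaleDl (f : KQ) :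
  {morph (@path_algebra_scale K Q)^~ f : a b / a + b}.
Proof. by move=> a b; apply: path_coef_inj => p; rewrite !coefE mulrDl. Qed.

HB.instance Definition _ := GRing.Zmodule_isLmodule.Build K KQ
  path_scaleA path_scale1 path_scaleDr path_scaleDl.

Lemma path_coef_linear p : linear_for *%R (path_coef p : KQ -> K).
Proof. by move=> a f g; rewrite !coefE. Qed.

HB.instance Definition _ p :=
  GRing.isLinear.Build K KQ K *%R (path_coef p) (path_coef_linear p).

Lemma path_supp_notin p (f : KQ) : p \notin path_supp f -> path_coef p f = 0.
Proof. exact: mcoeff_outdom. Qed.

Lemma path_supp_in p (f : KQ) : (p \in path_supp f) = (path_coef p f != 0).
Proof. exact/esym/mcoeff_neq0. Qed.

End PathModule.

HB.lock Definition path_basis (K : fieldType) (Q : quiver) (p : qpath Q) :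
  path_algebra K Q := << p >>.

(* linear extension of a map defined on paths *)
Definition path_ext (K : fieldType) (Q : quiver)
    (phi : qpath Q -> path_algebra K Q) (f : path_algebra K Q) :
    path_algebra K Q :=
  \sum_(p <- path_supp f) path_coef p f *: phi p.

(* The product is bilinear; on paths it is p followed by q, or 0. *)
HB.lock Definition path_algebra_mul (K : fieldType) (Q : quiver)
    (f g : path_algebra K Q) : path_algebra K Q :=
  path_ext
    (fun p => path_ext (fun q => oapp (@path_basis K Q) 0 (path_cat p q)) g) f.

Definition path_algebra_one (K : fieldType) (Q : quiver) : path_algebra K Q :=
  \sum_v path_basis K (trivial_path v).

Section PathAlgebra.
Variables (K : fieldType) (Q : quiver).

Local Notation KQ := (path_algebra K Q).
Local Notation path_basis := (@path_basis K Q).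
Local Notation path_algebra_one := (@path_algebra_one K Q).

Implicit Types (f g h : KQ) (p q r : qpath Q) (phi psi : qpath Q -> KQ).

Lemma path_coef_basis p q : path_coef q (path_basis p) = (p == q)%:R.
Proof. by rewrite path_basis.unlock; exact: (mcoeffU p 1 q). Qed.

Lemma path_extEw phi f (d : {fset qpath Q}) :
  {subset path_supp f <= d} ->
  path_ext phi f = \sum_(p <- d) path_coef p f *: phi p.
Proof.
move=> le_fd; apply: big_fset_incl => [|p _ pf]; first exact/fsubsetP.
by rewrite path_supp_notin // scale0r.
Qed.

Lemma path_ext_linear phi : linear (path_ext phi).
Proof.
move=> a f g.
pose d := fsetU (path_supp (a *: f + g)) (fsetU (path_supp f) (path_supp g)).
rewrite !(@path_extEw _ _ d); try by move=> p; rewrite !inE => ->; rewrite ?orbT.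
rewrite scaler_sumr -big_split; apply: eq_bigr => p _ /=.
by rewrite linearP scalerDl scalerA.
Qed.

HB.instance Definition _ phi :=
  GRing.isLinear.Build K KQ KQ *:%R (path_ext phi) (path_ext_linear phi).

Lemma path_algebraE f :
  f = \sum_(p <- path_supp f) path_coef p f *: path_basis p.
Proof.
apply: path_coef_inj => q; rewrite raddf_sum /=.
have [qf|qf] := boolP (q \in path_supp f).
  rewrite (big_fsetD1 q) //= big1_fset ?addr0 => [|p].
    by rewrite linearZ /= path_coef_basis eqxx mulr1.
  by rewrite !inE linearZ /= path_coef_basis => /andP[/negbTE-> _]; rewrite mulr0.
rewrite path_supp_notin // big1_fset // => p pf _.
rewrite linearZ /= path_coef_basis; case: eqP pf qf => [->->|_ _ _] //.
by rewrite mulr0.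
Qed.

Lemma path_ext_basis phi p : path_ext phi (path_basis p) = phi p.
Proof.
rewrite (@path_extEw _ _ [fset p]%fset) => [|q].
  by rewrite big_seq_fset1 path_coef_basis eqxx scale1r.
rewrite path_supp_in path_coef_basis; apply: contraR.
by rewrite inE eq_sym => /negbTE->.
Qed.

Lemma path_algebra_ind (P : KQ -> Prop) :
  P 0 -> (forall a f g, P f -> P g -> P (a *: f + g)) ->
  (forall p, P (path_basis p)) -> forall f, P f.
Proof.
move=> P0 PD Pb f; rewrite [f]path_algebraE.
by elim/big_rec: _ => // p g _ Pg; apply: PD.
Qed.

Lemma path_ext_linear2 a phi psi f :
  path_ext (fun p => a *: phi p + psi p) f
  = a *: path_ext phi f + path_ext psi f.
Proof.
rewrite /path_ext scaler_sumr -big_split; apply: eq_bigr => p _ /=.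
by rewrite scalerDr !scalerA mulrC.
Qed.

Lemma eq_path_ext phi psi f : phi =1 psi -> path_ext phi f = path_ext psi f.
Proof. by move=> e; apply: eq_bigr => p _; rewrite e. Qed.

Lemma path_mul_linl a f g h : path_algebra_mul (a *: f + g) h
  = a *: path_algebra_mul f h + path_algebra_mul g h.
Proof. rewrite path_algebra_mul.unlock; exact: path_ext_linear. Qed.

Lemma path_mul_linr a f g h : path_algebra_mul h (a *: f + g)
  = a *: path_algebra_mul h f + path_algebra_mul h g.
Proof.
rewrite path_algebra_mul.unlock.
apply: etrans (path_ext_linear2 _ _ _ _); apply: eq_path_ext => p.
exact: path_ext_linear.
Qed.

Lemma path_ext0 phi : path_ext phi 0 = 0.
Proof. exact: (raddf0 (path_ext phi)). Qed.

Lemma path_mul0l f : path_algebra_mul 0 f = 0.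
Proof. rewrite path_algebra_mul.unlock; exact: path_ext0. Qed.

Lemma path_mul0r f : path_algebra_mul f 0 = 0.
Proof.
rewrite path_algebra_mul.unlock.
by apply: big1 => p _; rewrite path_ext0 scaler0.
Qed.

Lemma path_mul_basis p q : path_algebra_mul (path_basis p) (path_basis q)
  = oapp path_basis 0 (path_cat p q).
Proof. by rewrite path_algebra_mul.unlock !path_ext_basis. Qed.

Lemma path_mulA : associative (@path_algebra_mul K Q).
Proof.
move=> f g h; elim/path_algebra_ind: f => [|a f f' IH IH'|p].
- by rewrite !path_mul0l.
- by rewrite !path_mul_linl IH IH'.
elim/path_algebra_ind: g => [|a f f' IH IH'|q].
- by rewrite !(path_mul0l, path_mul0r).
- by rewrite path_mul_linl !path_mul_linr path_mul_linl IH IH'.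
elim/path_algebra_ind: h => [|a f f' IH IH'|r].
- by rewrite !path_mul0r.
- by rewrite !path_mul_linr IH IH'.
rewrite !path_mul_basis; have := path_catA p q r.
case: (path_cat p q) (path_cat q r) => [u|] [w|] /=;
  rewrite ?path_mul0l ?path_mul0r ?path_mul_basis //; first by move=> ->.
- by move=> <-.
- by move=> ->.
Qed.

Lemma path_mul1l : left_id path_algebra_one (@path_algebra_mul K Q).
Proof.
move=> f; elim/path_algebra_ind: f => [|a f f' IH IH'|p].
- exact: path_mul0r.
- by rewrite path_mul_linr IH IH'.
rewrite /Defs.path_algebra_one.
rewrite (big_morph (fun f => path_algebra_mul f _) (id1 := 0) (op1 := +%R));
  first last.
- exact: path_mul0l.
- by move=> f g; have := path_mul_linl 1 f g (path_basis p); rewrite !scale1r.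
rewrite (bigD1 (path_start p)) //= big1 => [|v nv].
  by rewrite path_mul_basis trivial_path_cat eqxx addr0.
by rewrite path_mul_basis trivial_path_cat (negbTE nv).
Qed.

Lemma path_mul1r : right_id path_algebra_one (@path_algebra_mul K Q).
Proof.
move=> f; elim/path_algebra_ind: f => [|a f f' IH IH'|p].
- exact: path_mul0l.
- by rewrite path_mul_linl IH IH'.
rewrite /Defs.path_algebra_one.
rewrite (big_morph (path_algebra_mul _) (id1 := 0) (op1 := +%R)); first last.
- exact: path_mul0r.
- by move=> f g; have := path_mul_linr 1 f g (path_basis p); rewrite !scale1r.
rewrite (bigD1 (path_end p)) //= big1 => [|v nv].
  by rewrite path_mul_basis path_cat_trivial eqxx addr0.
by rewrite path_mul_basis path_cat_trivial eq_sym (negbTE nv).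
Qed.

Lemma path_mulDl : left_distributive (@path_algebra_mul K Q) +%R.
Proof. by move=> f g h; have := path_mul_linl 1 f g h; rewrite !scale1r. Qed.

Lemma path_mulDr : right_distributive (@path_algebra_mul K Q) +%R.
Proof. by move=> h f g; have := path_mul_linr 1 f g h; rewrite !scale1r. Qed.

Lemma path_one_neq0 : path_algebra_one != 0.
Proof.
have /card_gt0P[v _] := vertex_gt0 Q.
apply/eqP => /(congr1 (path_coef (trivial_path v))).
rewrite /Defs.path_algebra_one raddf_sum linear0 (bigD1 v) //= big1 => [|w nw].
  by rewrite path_coef_basis eqxx addr0 => /eqP; rewrite oner_eq0.
rewrite path_coef_basis; case: eqP => // /(congr1 (@path_start Q)) ewv.
by move: nw; rewrite (ewv : w = v) eqxx.
Qed.

HB.instance Definition _ := GRing.Zmodule_isNzRing.Build KQ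
  path_mulA path_mul1l path_mul1r path_mulDl path_mulDr path_one_neq0.

Lemma path_scalerAl (a : K) (f g : KQ) : a *: (f * g) = (a *: f) * g.
Proof. by have := path_mul_linl a f 0 g; rewrite path_mul0l !addr0. Qed.

Lemma path_scalerAr (a : K) (f g : KQ) : a *: (f * g) = f * (a *: g).
Proof. by have := path_mul_linr a g 0 f; rewrite path_mul0r !addr0. Qed.

HB.instance Definition _ := GRing.Lmodule_isLalgebra.Build K KQ path_scalerAl.
HB.instance Definition _ := GRing.Lalgebra_isAlgebra.Build K KQ path_scalerAr.

Lemma path_basisM p q :
  path_basis p * path_basis q = oapp path_basis 0 (path_cat p q).
Proof. exact: path_mul_basis. Qed.

Lemma path_algebra_oneE : 1 = \sum_v path_basis (trivial_path v) :> KQ.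
Proof. by []. Qed.

Definition arrow_elt (a : arrow Q) : KQ := path_basis (arrow_path a).

Definition arrow_ideal : set KQ := ideal_gen (range arrow_elt).

Definition admissible (I : set KQ) : Prop :=
  [/\ ideal I, I `<=` ideal_exp arrow_ideal 2 &
      exists2 m : nat, (2 <= m)%N & ideal_exp arrow_ideal m `<=` I].

Definition condition_M (I : set KQ) : Prop :=
  forall a : arrow Q,
    (forall b b' : arrow Q, ~ I (arrow_elt a * arrow_elt b) ->
       ~ I (arrow_elt a * arrow_elt b') -> b = b') /\
    (forall c c' : arrow Q, ~ I (arrow_elt c * arrow_elt a) ->
       ~ I (arrow_elt c' * arrow_elt a) -> c = c').

End PathAlgebra.

(* Functors between categories of left modules; morphisms are compared
   extensionally. *)
Record module_functor (R S : pzRingType) := ModuleFunctor {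
  fobj :> lmodType R -> lmodType S;
  fmor : forall U V : lmodType R, {linear U -> V} -> {linear fobj U -> fobj V};
  fmor_ext : forall (U V : lmodType R) (f g : {linear U -> V}),
    f =1 g -> fmor f =1 fmor g;
  fmor_id : forall U : lmodType R,
    fmor (idfun : {linear U -> U}) =1 idfun;
  fmor_comp : forall (U V W : lmodType R)
    (g : {linear V -> W}) (f : {linear U -> V}),
    fmor (g \o f : {linear U -> W}) =1 fmor g \o fmor f
}.

(* G \o F is naturally isomorphic to the identity functor. *)
Definition comp_iso_id (R S : pzRingType)
    (F : module_functor R S) (G : module_functor S R) : Prop :=
  exists eta : forall U : lmodType R, {linear G (F U) -> U},
    (forall U : lmodType R, bijective (eta U)) /\
    (forall (U V : lmodType R) (f : {linear U -> V}),
       eta V \o fmor G (fmor F f) =1 f \o eta U).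

Definition morita_equivalent (R S : pzRingType) : Prop :=
  exists (F : module_functor R S) (G : module_functor S R),
    comp_iso_id F G /\ comp_iso_id G F.

(* KQ/I is presented as an algebra B with a surjection KQ -> B of kernel I. *)
Definition special_multiserial (K : fieldType) (A : algType K) : Prop :=
  exists (Q : quiver) (I : set (path_algebra K Q)),
    [/\ admissible I, condition_M I &
      exists (B : algType K) (pi : {lrmorphism path_algebra K Q -> B}),
        [/\ forall b : B, exists x, pi x = b,
            forall x, pi x = 0 <-> I x &
            morita_equivalent A B]].

(* Main.v *)
(* Write B = KQ/I. By Morita theory A is a corner E M_n(B) E for an idempotent
   matrix E. Modulo the radical, E is diagonalizable, and lifting along the
   nilpotent radical makes A the ring of matrices (x_st) with x_st in
   e_(nu s) B e_(nu t) for some map nu into the vertices. This description is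
   left-right symmetric, so it suffices to treat A as a left module. By (M) the
   left ideal B a of an arrow a is a chain whose members are generated by paths,
   and the matrices supported in one column with entries in B a form a uniserial
   left ideal of A; these ideals add up to rad A. If paths p and q with distinct
   last arrows generate the same left ideal of B, then (M) yields
   rad(B) p = rad(B)^2 p, whence rad(B) p = 0 by nilpotency: two of the uniserial
   ideals meet in 0 or in a simple module. *)
From HB Require Import structures.
Require Import Defs.
From mathcomp Require Import all_boot all_order all_algebra all_field.
From mathcomp Require Import boolp classical_sets.

Set Implicit Arguments.
Unset Strict Implicit.
Unset Printing Implicit Defensive.

Import GRing.Theory.

Local Open Scope ring_scope.

(** * Rings with the ideal structure of a special multiserial quotient *)

(** The obstacle is that [I] need not be monomial. Condition (M) restricts only products of two
    arrows, so distinct nonzero paths may still be proportional in B, or agree modulo longer paths.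
    Hence the left ideals B a can overlap, and the overlap is bounded by a Nakayama argument instead
    of a comparison of bases of paths. What replaces bases is locality: each corner e_v B e_v
    consists of scalars modulo a nilpotent ideal, so an element e_v x of B a that misses the next
    member of the chain is a unit of a corner times a path. Scalars enter the axioms only as central
    units, so a frame is a statement about rings and passes to the converse ring. On the Morita side
    the functors are bare: additivity is no part of their definition and is derived from the natural
    isomorphisms. With F going from A-modules to B-modules, the matrix size n is the number of terms
    in an expression of 1 in A as a sum of values of maps from G(B) to A. *)

(* The only features of KQ/I that matter: [J k] is the image of the span of the
   paths of length at least k, and [nxt a], [prv a] are the arrows that may
   follow or precede [a]. The axioms are self-dual, so that each one-sided
   result also applies to the converse ring. *)
Record arrow_frame (B : pzRingType) (V Ar : finType) (e : V -> B)
    (src tgt : Ar -> V) (el : Ar -> B) (nxt prv : Ar -> Ar)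
    (J : nat -> B -> Prop) : Prop := ArrowFrame {
  frame_one : 1 = \sum_v e v;
  frame_orth : forall v w, e v * e w = if v == w then e v else 0;
  frame_src : forall a, e (src a) * el a = el a;
  frame_tgt : forall a, el a * e (tgt a) = el a;
  frame_M : forall a b, el a * el b <> 0 -> nxt a = b /\ prv b = a;
  frame_el : forall a, J 1%N (el a);
  frame_J0 : forall x, J 0%N x;
  frame_nil : exists m, forall x, J m x -> x = 0;
  frame_zero : forall k, J k 0;
  frame_add : forall k x y, J k x -> J k y -> J k (x + y);
  frame_mul : forall i j x y, J i x -> J j y -> J (i + j)%N (x * y);
  frame_left : forall k x, J k.+1 x ->
    exists y : Ar -> B, (forall a, J k (y a)) /\ x = \sum_a y a * el a;
  frame_right : forall k x, J k.+1 x ->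
    exists y : Ar -> B, (forall a, J k (y a)) /\ x = \sum_a el a * y a;
  frame_off : forall v w x, v <> w -> J 1%N (e v * x * e w);
  frame_diag : forall v x, J 1%N (e v * x * e v) \/
    exists c c' : B, [/\ forall y, c * y = y * c, c * c' = 1 &
      J 1%N (e v * x * e v - c * e v)]
}.

Section Converse.
Variables (B : pzRingType) (V Ar : finType) (e : V -> B) (src tgt : Ar -> V).
Variables (el : Ar -> B) (nxt prv : Ar -> Ar) (J : nat -> B -> Prop).
Hypothesis frB : arrow_frame e src tgt el nxt prv J.

Lemma arrow_frame_converse :
  @arrow_frame B^c V Ar e tgt src el prv nxt J.
Proof.
split.
- exact: (frame_one frB).
- move=> v w; apply: etrans (frame_orth frB w v) _.
  by rewrite eq_sym; case: eqP => [->|].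
- exact: (frame_tgt frB).
- exact: (frame_src frB).
- by move=> a b /(frame_M frB)[].
- exact: (frame_el frB).
- exact: (frame_J0 frB).
- exact: (frame_nil frB).
- exact: (frame_zero frB).
- exact: (frame_add frB).
- by move=> i j x y xi yj; rewrite addnC; apply: (frame_mul frB yj xi).
- exact: (frame_right frB).
- exact: (frame_left frB).
- move=> v w x nvw; have := frame_off frB x (nesym nvw).
  by rewrite -mulrA.
- move=> v x; case: (frame_diag frB v x) => [h|[c [c' [cC cc h]]]].
    by left; move: h; rewrite -mulrA.
  right; exists c, c'; split.
  + by move=> y; apply: esym; apply: cC.
  + exact: etrans (esym (cC c')) cc.
  by move: h; rewrite -mulrA cC.
Qed.

End Converse.

Section Frame.
Variables (B : pzRingType) (V Ar : finType) (e : V -> B) (src tgt : Ar -> V).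
Variables (el : Ar -> B) (nxt prv : Ar -> Ar) (J : nat -> B -> Prop).
Hypothesis frB : arrow_frame e src tgt el nxt prv J.

Lemma frame_idem v : e v * e v = e v.
Proof. by rewrite (frame_orth frB) eqxx. Qed.

Lemma frame_mulr k x y : J k y -> J k (x * y).
Proof. by move=> ky; rewrite -[k]add0n; apply: (frame_mul frB) (frame_J0 frB _) ky. Qed.

Lemma frame_mull k x y : J k x -> J k (x * y).
Proof. by move=> kx; rewrite -[k]addn0; apply: (frame_mul frB) kx (frame_J0 frB _). Qed.

Lemma frame_opp k x : J k x -> J k (- x).
Proof. by rewrite -mulN1r; apply: frame_mulr. Qed.

Lemma frame_sum k (I : Type) (r : seq I) (P : pred I) (F : I -> B) :
  (forall i, P i -> J k (F i)) -> J k (\sum_(i <- r | P i) F i).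
Proof.
by move=> h; apply: big_ind h; [apply: (frame_zero frB) | apply: (frame_add frB)].
Qed.

Lemma frame_decr k x : J k.+1 x -> J k x.
Proof.
move=> /(frame_left frB)[y [yk ->]]; apply: frame_sum => a _.
exact: frame_mull.
Qed.

Lemma frame_geometric n : J 1%N n -> exists g, g * (1 + n) = 1.
Proof.
move=> n1; have [m m0] := frame_nil frB.
suff [g [r [rm gE]]] : exists g r, J m r /\ g * (1 + n) = 1 + r.
  by exists g; rewrite gE (m0 _ rm) addr0.
(* The error [r] starts as -1, which lies in [J 0], and each round multiplies it by [- n]. *)
elim: m {m0} => [|m [g [r [rm gE]]]].
  by exists 0, (-1); split; [apply: (frame_J0 frB) | rewrite mul0r subrr].
exists (g - r), (- (r * n)); split.
  by apply: frame_opp; rewrite -addn1; apply: (frame_mul frB).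
by rewrite mulrBl gE mulrDr mulr1 opprD addrA addrK.
Qed.

(* The corner rings e_v B e_v are local. *)
Lemma frame_corner_inv v z : z = e v * z -> z = z * e v -> ~ J 1%N z ->
  exists z', [/\ z' = z' * e v, z' = e v * z' & z' * z = e v].
Proof.
move=> zl zr nz.
have ez : e v * z * e v = z by rewrite -zl -zr.
case: (frame_diag frB v z); rewrite ez // => -[c [c' [cC cc zc]]].
have [g gE] := frame_geometric (frame_mulr c' zc).
(* Dividing by the residue [c] leaves a unipotent factor times [e v], and the geometric series
   inverts that factor. *)
have zE : c' * z = (1 + c' * (z - c * e v)) * e v.
  rewrite mulrDl mul1r -mulrA mulrBl -zr -mulrA frame_idem mulrBr mulrA -cC cc.
  by rewrite mul1r addrC subrK.
exists (e v * (g * c') * e v); split.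
- by rewrite -[RHS]mulrA frame_idem.
- by rewrite !mulrA frame_idem.
by rewrite -!mulrA -zl zE [g * _]mulrA gE mul1r frame_idem.
Qed.

Lemma frame_split_l x : x = \sum_v e v * x.
Proof. by rewrite -mulr_suml -(frame_one frB) mul1r. Qed.

(** The only candidate for a nonzero path of [k.+1] arrows ending in [a]. Where no arrow precedes,
    the value of [prv] is arbitrary, but the product is then 0 by [frame_M]. *)
Fixpoint left_path (k : nat) (a : Ar) : B :=
  if k is k'.+1 then el (iter k prv a) * left_path k' a else el a.

Lemma left_path_src k a : e (src (iter k prv a)) * left_path k a = left_path k a.
Proof. by case: k => [|k] /=; rewrite ?mulrA (frame_src frB). Qed.

Lemma left_path_deg k a : J k.+1 (left_path k a).
Proof.
elim: k => [|k IH]; first exact: (frame_el frB).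
by rewrite -[k.+2]add1n; apply: (frame_mul frB) (frame_el frB _) IH.
Qed.

Lemma left_path_prv k a b : b <> iter k.+1 prv a -> el b * left_path k a = 0.
Proof.
move=> nb; have bz : el b * el (iter k prv a) = 0.
  by case: (eqVneq (el b * el (iter k prv a)) 0) => // /eqP/(frame_M frB)[_ /esym/nb].
by case: k bz {nb} => [|k] //= bz; rewrite mulrA bz mul0r.
Qed.

(** Of the arrows in a decomposition of [x], only [iter k.+1 prv a] survives against the path. So
    the radical moves each member of the chain into the next. *)
Lemma left_path_rad k a x : J 1%N x ->
  exists y, x * left_path k a = y * left_path k.+1 a.
Proof.
move=> /(frame_left frB)[y [_ ->]]; exists (y (iter k.+1 prv a)).
rewrite mulr_suml (bigD1 (iter k.+1 prv a)) //= big1 ?addr0 ?mulrA // => b /eqP nb.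
by rewrite -mulrA left_path_prv ?mulr0.
Qed.

Lemma left_path_cat i k a :
  left_path (i + k).+1 a = left_path i (iter k.+1 prv a) * left_path k a.
Proof.
elim: i => [|i IH]; first by [].
change (el (iter (i + k).+2 prv a) * left_path (i + k).+1 a =
  el (iter i.+1 prv (iter k.+1 prv a)) * left_path i (iter k.+1 prv a) *
  left_path k a).
by rewrite IH mulrA -iterD addnS.
Qed.

(** Consecutive arrows of a nonzero path have nonzero product, so [nxt] undoes [prv] along it. *)
Lemma left_path_nxt i a : left_path i a <> 0 ->
  forall k, (k <= i)%N -> iter k nxt (iter i prv a) = iter (i - k) prv a.
Proof.
elim: i => [|i IH] nz k; first by rewrite leqn0 => /eqP ->.
have nz' : left_path i a <> 0 by move=> h; apply: nz; rewrite /= h mulr0.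
have h : nxt (iter i.+1 prv a) = iter i prv a.
  apply: (proj1 (frame_M frB _)) => h.
  by apply: nz; case: i h {IH nz'} => [|i] //= h; rewrite mulrA h mul0r.
case: k => [|k] // ki; rewrite iterSr h IH ?subSS //.
Qed.

Lemma left_path_next k a b : el b * left_path k a <> 0 -> nxt b = iter k prv a.
Proof.
move=> nz; apply: (proj1 (frame_M frB _)) => h; apply: nz.
by case: k h => [|k] //= h; rewrite mulrA h mul0r.
Qed.

(* Nakayama's lemma for the cyclic module generated by [p]. *)
Lemma frame_nakayama p :
  (forall a, exists y, J 2%N y /\ el a * p = y * p) ->
  forall x, J 1%N x -> x * p = 0.
Proof.
move=> /choice[f fP].
have step k x : J k.+1 x -> exists2 y, J k.+2 y & x * p = y * p.
  move=> /(frame_left frB)[y [yk ->]].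
  exists (\sum_a y a * f a).
    by apply: frame_sum => a _; rewrite -addn2; apply: (frame_mul frB) => //; have [] := fP a.
  rewrite !mulr_suml; apply: eq_bigr => a _.
  by rewrite -!mulrA; have [_ ->] := fP a.
move=> x x1; have [m m0] := frame_nil frB.
have [y ym ->] : exists2 y, J m.+1 y & x * p = y * p.
  elim: m {m0} => [|k [y yk ->]]; [by exists x | exact: step].
by rewrite (m0 _ (frame_decr ym)) mul0r.
Qed.

Definition left_multiple (p x : B) : Prop := exists y, x = y * p.

Lemma left_multiple_rad k a x : left_multiple (left_path k.+1 a) x ->
  left_multiple (left_path k a) x.
Proof. by move=> [y ->]; exists (y * el (iter k.+1 prv a)); rewrite -mulrA. Qed.

Lemma left_multiple_le i j a x : (i <= j)%N ->
  left_multiple (left_path j a) x -> left_multiple (left_path i a) x.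
Proof.
move=> /subnK <-; elim: (j - i)%N => [|k IH] //.
by move=> /left_multiple_rad.
Qed.

Lemma left_multiple_sum p (I : finType) (F : I -> B) :
  (forall i, left_multiple p (F i)) -> left_multiple p (\sum_i F i).
Proof.
by move=> /choice[f fE]; exists (\sum_i f i); rewrite mulr_suml; apply: eq_bigr.
Qed.

Lemma left_multiple_mul p x y : left_multiple p x -> left_multiple p (y * x).
Proof. by move=> [z ->]; exists (y * z); rewrite mulrA. Qed.

(** The descent stops because [left_path m a] is 0 for large [m]. A family is needed for the entries
    of a matrix column and for the components [e v * x]. *)
Lemma left_path_level (T : Type) (x : T -> B) a :
  (forall s, left_multiple (el a) (x s)) -> (exists s, x s <> 0) ->
  exists2 i, forall s, left_multiple (left_path i a) (x s) &
    exists s, ~ left_multiple (left_path i.+1 a) (x s).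
Proof.
move=> x0 [s sn]; apply: contrapT => H.
have all_i i : forall t, left_multiple (left_path i a) (x t).
  elim: i => [|i IH] //; apply: contrapT => h; apply: H; exists i => //.
  apply: contrapT => h'; apply: h => t; apply: contrapT => h''; apply: h'.
  by exists t.
have [m m0] := frame_nil frB.
have [y yE] := all_i m s; apply: sn; rewrite yE (m0 (left_path m a)) ?mulr0 //.
exact/frame_decr/left_path_deg.
Qed.

(** Write [x] as [z] times the path, [z] in a corner. If [z] were in [J 1], then [x] would drop one
    step down the chain. So the corner is diagonal, hence local, and [z] is invertible there. *)
Lemma left_path_recover i a v x : x = e v * x ->
  left_multiple (left_path i a) x -> ~ left_multiple (left_path i.+1 a) x ->
  v = src (iter i prv a) /\ exists2 z, z = z * e v & z * x = left_path i a.
Proof.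
set w := src _ => xv [z0 xE] nx.
pose z := e v * z0 * e w.
have {}xE : x = z * left_path i a.
  by rewrite xv xE /z -!mulrA left_path_src.
have nz : ~ J 1%N z.
  by move=> /left_path_rad-/(_ i a)[y]; rewrite -xE => yE; apply: nx; exists y.
have evw : v = w by apply: contrapT => /(frame_off frB)-/(_ z0)/nz.
split=> //.
have [||z' [zr _ zz]] := @frame_corner_inv v z _ _ nz.
- by rewrite /z !mulrA frame_idem.
- by rewrite /z evw -!mulrA frame_idem.
by exists z' => //; rewrite xE mulrA zz evw left_path_src.
Qed.

Lemma left_path_generates a x : left_multiple (el a) x -> x <> 0 ->
  exists i, left_multiple x (left_path i a) /\ left_multiple (left_path i a) x.
Proof.
move=> xa nx.
have [||i xi [s ns]] := @left_path_level V (fun v => e v * x) a.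
- by move=> v; apply: left_multiple_mul.
- apply: contrapT => h; apply: nx; rewrite [x]frame_split_l; apply: big1 => v _.
  by apply: contrapT => h'; apply: h; exists v.
have es : e s * x = e s * (e s * x) by rewrite mulrA frame_idem.
have [_ [z _ zE]] := left_path_recover es (xi s) ns.
exists i; split; first by exists (z * e s); rewrite -mulrA.
by rewrite [x]frame_split_l; apply: left_multiple_sum.
Qed.

Lemma frame_self_multiple p u n : p = u * p * n -> J 1%N n -> p = 0.
Proof.
move=> pE n1; have [m m0] := frame_nil frB.
have [u' [n' [n'm ->]]] : exists u' n', J m n' /\ p = u' * p * n'.
  elim: m {m0} => [|k [u' [n' [n'k pE']]]].
    by exists 1, 1; split; [apply: (frame_J0 frB) | rewrite mul1r mulr1].
  exists (u' * u), (n * n'); split; first by rewrite -add1n; apply: (frame_mul frB).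
  by rewrite {1}pE' {1}pE !mulrA.
by rewrite (m0 _ n'm) mulr0.
Qed.

(* Left paths p and q that begin with the same arrow have the same successors,
   so q = p m when q is the longer one; then p = u q = u p m, and iterating
   gives p = u^k p m^k = 0. *)
Lemma left_path_same_src i j a a' : a <> a' -> (i <= j)%N ->
  iter i prv a = iter j prv a' -> left_path i a <> 0 -> left_path j a' <> 0 ->
  left_multiple (left_path j a') (left_path i a) -> False.
Proof.
move=> na ij Ea nzi nzj [u pE].
have aE : a = iter (j - i) prv a'.
  have := left_path_nxt nzi (leqnn i); rewrite subnn /= => <-.
  by rewrite Ea left_path_nxt.
case ji: (j - i)%N aE => [|k] aE; first by apply: na.
have jE : j = (i + k).+1 by rewrite -addnS -ji subnKC.
apply: nzi; apply: (@frame_self_multiple _ u (left_path k a')).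
  by rewrite {1}pE jE left_path_cat aE mulrA.
have: J (1 + k) (left_path k a') by rewrite add1n; apply: left_path_deg.
elim: {aE jE ji} k (left_path k a') => [|k IH] y; first by [].
by rewrite addnS => /frame_decr; apply: IH.
Qed.

(* Let p and q be left paths from a and a' generating the same left ideal, with
   distinct first arrows. An arrow b that can precede p cannot precede q, so
   from p = u q with u a scalar modulo the radical, b p lies in J^2 p. *)
Lemma left_path_socle a a' x y : a <> a' ->
  left_multiple (el a) x -> left_multiple (el a') x -> J 1%N y -> y * x = 0.
Proof.
move=> na xa xa' y1; apply: contrapT => nyx.
have nx : x <> 0 by move=> x0; apply: nyx; rewrite x0 mulr0.
have [i [[s pE] [r xE]]] := left_path_generates xa nx.
have [j [[s' qE] [r' xE']]] := left_path_generates xa' nx.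
set p := left_path i a in pE xE; set q := left_path j a' in qE xE'.
have np : p <> 0 by move=> h; apply: nx; rewrite xE h mulr0.
have nq : q <> 0 by move=> h; apply: nx; rewrite xE' h mulr0.
have pq : p = (s * r') * q by rewrite pE {1}xE' mulrA.
have qp : q = (s' * r) * p by rewrite qE {1}xE mulrA.
case: (eqVneq (iter i prv a) (iter j prv a')) => [E|/eqP nE].
  case: (leqP i j) => [|/ltnW] ij.
    by apply: (left_path_same_src na ij E np nq); exists (s * r').
  by apply: (left_path_same_src (nesym na) ij (esym E) nq np); exists (s' * r).
apply: nyx; rewrite xE mulrA; apply: frame_nakayama (frame_mull r y1) => b.
have [bp|nbp] := pselect (el b * p = 0).
  by exists 0; split; [apply: (frame_zero frB) | rewrite bp mul0r].
have bq : el b * q = 0.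
  apply: contrapT => nbq; apply: nE.
  by rewrite -(left_path_next nbp) -(left_path_next nbq).
pose u := e (src (iter i prv a)) * (s * r') * e (src (iter j prv a')).
have pu : p = u * q by rewrite -mulrA left_path_src -mulrA -pq left_path_src.
(* A radical factor between [el b] and [q] raises the degree to 2, and [q] is itself a multiple of
   [p]. *)
have lift n : J 1%N n -> exists z, J 2%N z /\ el b * (n * q) = z * p.
  move=> n1; exists (el b * n * (s' * r)); split; last by rewrite {1}qp !mulrA.
  by apply: frame_mull; apply: (frame_mul frB (frame_el frB b) n1).
case: (eqVneq (src (iter i prv a)) (src (iter j prv a'))) => [Es|/eqP nEs]; last first.
  by rewrite {1}pu; apply/lift/(frame_off frB).
rewrite {1}pu; case: (frame_diag frB (src (iter i prv a)) (s * r')) => [|[c [c' [cC _ un]]]].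
  by rewrite {2}Es; apply: lift.
have [z [z2 zE]] := lift _ un; exists z; split=> //.
have cq : el b * (c * e (src (iter i prv a)) * q) = 0.
  by rewrite -(mulrA c) Es left_path_src mulrA -cC -mulrA bq mulr0.
by rewrite -zE mulrBl mulrBr cq subr0 /u -Es.
Qed.

End Frame.
(** * Matrix rings over a frame *)

(* [phi] identifies A with the ring of T x T matrices over B whose (s, t) entry
   lies in e_(nu s) B e_(nu t). *)
Record matrix_model (A B : pzRingType) (V T : finType) (e : V -> B) (nu : T -> V)
    (phi : A -> T -> T -> B) : Prop := MatrixModel {
  model_add : forall x y s t, phi (x + y) s t = phi x s t + phi y s t;
  model_mul : forall x y s t, phi (x * y) s t = \sum_r phi x s r * phi y r t;
  model_l : forall x s t, e (nu s) * phi x s t = phi x s t;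
  model_r : forall x s t, phi x s t * e (nu t) = phi x s t;
  model_inj : forall x y, (forall s t, phi x s t = phi y s t) -> x = y;
  model_surj : forall X : T -> T -> B,
    exists x, forall s t, phi x s t = e (nu s) * X s t * e (nu t)
}.

Lemma matrix_model_converse (A B : pzRingType) (V T : finType) (e : V -> B)
    (nu : T -> V) (phi : A -> T -> T -> B) :
  matrix_model e nu phi ->
  @matrix_model A^c B^c V T e nu (fun x s t => phi x t s).
Proof.
move=> mm; split.
- by move=> x y s t; apply: (model_add mm).
- by move=> x y s t; apply: (model_mul mm).
- by move=> x s t; apply: (model_r mm).
- by move=> x s t; apply: (model_l mm).
- by move=> x y h; apply: (model_inj mm) => s t; apply: h.
- move=> X; have [x xE] := model_surj mm (fun s t => X t s).
  by exists x => s t; apply: etrans (xE t s) _; rewrite -mulrA.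
Qed.

(** * Uniserial columns and the radical of the matrix ring *)

Section MatrixModel.
Variables (B : pzRingType) (V Ar : finType) (e : V -> B) (src tgt : Ar -> V).
Variables (el : Ar -> B) (nxt prv : Ar -> Ar) (J : nat -> B -> Prop).
Hypothesis frB : arrow_frame e src tgt el nxt prv J.
Variables (A : pzRingType) (T : finType) (nu : T -> V) (phi : A -> T -> T -> B).
Hypothesis mm : matrix_model e nu phi.

Local Open Scope classical_set_scope.

Let left_path := left_path el prv.

Lemma model0 s t : phi 0 s t = 0.
Proof. by apply: (addIr (phi 0 s t)); rewrite -(model_add mm) !add0r. Qed.

Lemma modelN x s t : phi (- x) s t = - phi x s t.
Proof. by apply: (addIr (phi x s t)); rewrite -(model_add mm) !addNr model0. Qed.

Lemma model_sum (I : finType) (F : I -> A) s t :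
  phi (\sum_i F i) s t = \sum_i phi (F i) s t.
Proof.
exact: (big_morph (fun x => phi x s t) (fun x y => model_add mm x y s t) (model0 s t)).
Qed.

Definition model_rad (k : nat) (x : A) : Prop := forall s t, J k (phi x s t).

Lemma model_rad_mul i j x y : model_rad i x -> model_rad j y -> model_rad (i + j) (x * y).
Proof.
move=> xi yj s t; rewrite (model_mul mm); apply: (frame_sum frB) => r _.
exact: (frame_mul frB).
Qed.

Lemma model_rad_geometric n : model_rad 1 n -> exists g, g * (1 - n) = 1.
Proof.
move=> n1; have [m m0] := frame_nil frB.
suff [g [r [rm gE]]] : exists g r, model_rad m.+1 r /\ g * (1 - n) = 1 - r.
  exists g; rewrite gE (_ : r = 0) ?subr0 //; apply: (model_inj mm) => s t.
  by rewrite model0 (m0 _ (frame_decr frB (rm s t))).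
elim: m {m0} => [|m [g [r [rm gE]]]]; first by exists 1, n; rewrite mul1r.
exists (g + r), (r * n); split; first by rewrite -addn1; apply: model_rad_mul.
by rewrite mulrDl gE mulrBr mulr1 addrA subrK.
Qed.

Lemma submodule_mul (N : set A^o) : submodule N -> forall a x, N x -> N (a * x).
Proof. by move=> [N0 NP] a x Nx; have := NP a x 0 Nx N0; rewrite addr0. Qed.

Lemma submodule_add (N : set A^o) : submodule N -> forall x y, N x -> N y -> N (x + y).
Proof. by move=> [N0 NP] x y Nx Ny; have := NP 1 x y Nx Ny; rewrite scale1r. Qed.

Definition in_column (t : T) (x : A) : Prop := forall s r, r <> t -> phi x s r = 0.

Lemma in_column_neq0 t x : in_column t x -> x <> 0 -> exists s, phi x s t <> 0.
Proof.
move=> xt nx; apply: contrapT => h; apply: nx; apply: (model_inj mm) => s r.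
rewrite model0; have [->|/eqP/xt//] := eqVneq r t.
by apply: contrapT => h'; apply: h; exists s.
Qed.

(** One entry of [x] can be multiplied back to [left_path i a], so a matrix [c] supported in column
    [s] rebuilds the whole column of [y] from that entry. *)
Lemma in_column_multiple t x y a i s : in_column t x -> in_column t y ->
  (forall r, left_multiple (left_path i a) (phi y r t)) ->
  left_multiple (left_path i a) (phi x s t) ->
  ~ left_multiple (left_path i.+1 a) (phi x s t) ->
  exists c, y = c * x.
Proof.
move=> xt yt /choice[y' yE] xi nxi.
have [_ [z zs zE]] := left_path_recover frB (esym (model_l mm x s t)) xi nxi.
have [c cE] := model_surj mm (fun r s' => if s' == s then y' r * z else 0).
exists c; apply: (model_inj mm) => r t'.
rewrite (model_mul mm) (bigD1 s) //= big1 ?addr0 => [|s' /negbTE ns]; last first.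
  by rewrite cE ns mulr0 !mul0r.
have [->|/eqP nt] := eqVneq t' t; last by rewrite (yt _ _ nt) (xt _ _ nt) mulr0.
by rewrite cE eqxx -!mulrA (model_l mm) zE -yE (model_l mm).
Qed.

(** For [nu t <> tgt a] this is the zero submodule, so all pairs in [T * Ar] can serve as
    indices. *)
Definition arrow_column (t : T) (a : Ar) : set A^o :=
  [set x | in_column t x /\ forall s, left_multiple (el a) (phi x s t)].

Lemma arrow_column_submodule t a : submodule (arrow_column t a).
Proof.
split; first by split=> [s r _|s]; rewrite model0 //; exists 0; rewrite mul0r.
move=> c x y [xt xa] [yt ya]; split=> [s r nr|s].
  rewrite (model_add mm) (yt _ _ nr) addr0 (model_mul mm) big1 // => q _.
  by rewrite (xt _ _ nr) mulr0.
rewrite (model_add mm).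
have [u uE] := ya s.
have [|v vE] := @left_multiple_sum B (el a) T (fun q => phi c s q * phi x q t).
  by move=> q; apply: left_multiple_mul.
by exists (v + u); rewrite mulrDl -vE -uE (model_mul mm).
Qed.

Lemma arrow_column_level t a x : arrow_column t a x -> x <> 0 ->
  exists i, (forall s, left_multiple (left_path i a) (phi x s t)) /\
    exists s, ~ left_multiple (left_path i.+1 a) (phi x s t).
Proof.
move=> [xt xa] /(in_column_neq0 xt) nx.
by have [i] := left_path_level frB xa nx; exists i.
Qed.

Lemma arrow_column_multiple t a x y i j : (i <= j)%N ->
  arrow_column t a x -> arrow_column t a y ->
  (forall s, left_multiple (left_path i a) (phi x s t)) ->
  (exists s, ~ left_multiple (left_path i.+1 a) (phi x s t)) ->
  (forall s, left_multiple (left_path j a) (phi y s t)) ->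
  exists c, y = c * x.
Proof.
move=> ij [xt _] [yt _] xi [s nxi] yj.
apply: (in_column_multiple xt yt _ (xi s) nxi) => r.
exact: left_multiple_le ij (yj r).
Qed.

(** Levels are natural numbers, hence comparable, and an element of smaller level generates every
    element of larger level. *)
Lemma arrow_column_uniserial t a : uniserial (arrow_column t a).
Proof.
split; first exact: arrow_column_submodule.
move=> N N' sN sN' NU NU'.
have [NN'|nNN'] := pselect (N `<=` N'); [by left | right=> y N'y].
have [x Nx nN'x] : exists2 x, N x & ~ N' x.
  by apply: contrapT => h; apply: nNN' => x Nx; apply: contrapT => h'; apply: h; exists x.
have [->|/eqP ny] := eqVneq y 0; first by case: sN.
have nx : x <> 0 by move=> x0; apply: nN'x; rewrite x0; case: sN'.
have [i [xi nxi]] := arrow_column_level (NU _ Nx) nx.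
have [j [yj nyj]] := arrow_column_level (NU' _ N'y) ny.
case: (leqP i j) => [|/ltnW] ij.
  have [c ->] := arrow_column_multiple ij (NU _ Nx) (NU' _ N'y) xi nxi yj.
  exact: submodule_mul.
have [c xE] := arrow_column_multiple ij (NU' _ N'y) (NU _ Nx) yj nyj xi.
by case: nN'x; rewrite xE; apply: submodule_mul.
Qed.

(** By [left_path_socle] the radical kills the entries of [x], while one of them generates
    [left_path i a]; so this path dies when extended by one arrow. *)
Lemma arrow_column_socle t a a' x i : a <> a' ->
  arrow_column t a x -> arrow_column t a' x ->
  (forall s, left_multiple (left_path i a) (phi x s t)) ->
  (exists s, ~ left_multiple (left_path i.+1 a) (phi x s t)) ->
  left_path i.+1 a = 0.
Proof.
move=> na [_ xa] [_ xa'] xi [s nxi].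
have [_ [z _ zE]] := left_path_recover frB (esym (model_l mm x s t)) (xi s) nxi.
rewrite /left_path /= -zE mulrA.
exact: (left_path_socle frB na (xa s) (xa' s) (frame_mull frB _ (frame_el frB _))).
Qed.

Lemma arrow_columnI t a t' a' : (t, a) <> (t', a') ->
  arrow_column t a `&` arrow_column t' a' = [set 0] \/
  simple_submodule (arrow_column t a `&` arrow_column t' a').
Proof.
move=> nta; have [z|nz] := pselect (arrow_column t a `&` arrow_column t' a' = [set 0]);
  [by left | right].
have sub0 u b : arrow_column u b 0 by case: (arrow_column_submodule u b).
have Ett' : t' = t.
  apply: contrapT => ntt; apply: nz; apply/seteqP; split=> [x [[xt _] [xt' _]]|x ->]; last first.
    by split; apply: sub0.
  apply: (model_inj mm) => s r; rewrite model0.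
  have [->|/eqP] := eqVneq r t; [exact/xt'/nesym | exact: xt].
rewrite {}Ett' in nta nz *.
have na : a <> a' by move=> h; apply: nta; rewrite h.
split=> //.
  split; first by split; apply: sub0.
  move=> c x y [xa xa'] [ya ya'].
  by split; [apply: (arrow_column_submodule t a).2 | apply: (arrow_column_submodule t a').2].
move=> N sN NW; have [N0|nN] := pselect (N = [set 0]); [by left | right].
have [x Nx nx] : exists2 x, N x & x <> 0.
  apply: contrapT => h; apply: nN; apply/seteqP; split=> [x Nx|x ->]; last by case: sN.
  by apply: contrapT => h'; apply: h; exists x.
apply/seteqP; split=> // y [ya ya'].
have [->|/eqP ny] := eqVneq y 0; first by case: sN.
have [xa xa'] := NW _ Nx.
have [i [xi nxi]] := arrow_column_level xa nx.
have [j [yj nyj]] := arrow_column_level ya ny.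
case: (leqP i j) => ij.
  have [c ->] := arrow_column_multiple ij xa ya xi nxi yj.
  exact: submodule_mul.
(* Here [y] lies strictly above [x] in the chain; but [y] is in both columns, so the chain ends just
   below [y], and every entry of [x] would be 0. *)
have yz := arrow_column_socle na ya ya' yj nyj.
have pz : left_path i a = 0.
  have [|u ->] := @left_multiple_le B Ar el prv j.+1 i a (left_path i a) ij.
    by exists 1; rewrite mul1r.
  by rewrite -/left_path yz mulr0.
case: nxi => s []; have [u uE] := xi s.
by exists 0; rewrite uE pz mulr0 mul0r.
Qed.

(** Otherwise maximality gives [1 = n + c * x] with [n] in [N], and [1 - c * x] is left invertible,
    so [N] contains 1. *)
Lemma model_rad_maximal (N : set A^o) x : maximal_submodule N -> model_rad 1 x -> N x.
Proof.
move=> [sN nT maxN] xJ; apply: contrapT => nx.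
pose N' : set A^o := [set y | exists n c, N n /\ y = n + c * x].
have sN' : submodule N'.
  split; first by exists 0, 0; rewrite mul0r addr0; case: sN.
  move=> d y z [n [c [Nn ->]]] [n' [c' [Nn' ->]]].
  exists (d * n + n'), (d * c + c'); split; first exact: sN.2.
  by rewrite /GRing.scale /= mulrDr mulrDl addrACA mulrA.
case: (maxN N' sN') => [y Ny|E|E].
- by exists y, 0; rewrite mul0r addr0.
- by apply: nx; rewrite -E; exists 0, 1; rewrite mul1r add0r; case: sN.
have [n [c [Nn E1]]] : N' 1 by rewrite E.
have [|g gE] := @model_rad_geometric (c * x).
  by rewrite -[1%N]add0n; apply: model_rad_mul => // s t; apply: (frame_J0 frB).
have N1 : N 1 by rewrite -gE E1 addrK; apply: submodule_mul.
apply: nT; apply/seteqP; split=> // y _; rewrite -[y]mulr1; exact: submodule_mul.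
Qed.

(** For each [t], if some matrix has an entry of column [t] outside [J 1], then the matrices with
    column [t] in [J 1] form a maximal left ideal. *)
Lemma radical_model_rad x : radical (M := A^o) x -> model_rad 1 x.
Proof.
move=> xr s t; apply: contrapT => nJ.
pose N : set A^o := [set y | forall r, J 1%N (phi y r t)].
suff maxN : maximal_submodule N by apply: nJ; apply: (xr N maxN).
have sN : submodule N.
  split=> [r|c y z Ny Nz r]; first by rewrite model0; apply: (frame_zero frB).
  rewrite (model_add mm) (model_mul mm); apply: (frame_add frB) (Nz r).
  by apply: (frame_sum frB) => q _; apply: (frame_mulr frB).
split=> //; first by move=> E; apply: nJ; have : N x by rewrite E.
move=> N' sN' NN'; have [N'N|nN'N] := pselect (N' `<=` N).
  by left; apply/seteqP.
right; have [y N'y [r ny]] : exists2 y, N' y & exists r, ~ J 1%N (phi y r t).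
  apply: contrapT => h; apply: nN'N => y N'y r; apply: contrapT => h'; apply: h.
  by exists y => //; exists r.
have Ert : nu r = nu t.
  apply: contrapT => nrt; apply: ny; have := frame_off frB (phi y r t) nrt.
  by rewrite (model_l mm) (model_r mm).
have [||z [zr zl zE]] := frame_corner_inv frB (v := nu t) (z := phi y r t) _ _ ny.
- by rewrite -Ert (model_l mm).
- by rewrite (model_r mm).
apply/seteqP; split=> // w _.
(* As [z] inverts the entry of [y] at [(r, t)], the matrices [c * y] and [w] agree in column [t], so
   their difference lies in [N]. *)
have [c cE] := model_surj mm (fun s q => if q == r then phi w s t * z else 0).
have -> : w = c * y + (w - c * y) by rewrite addrC subrK.
apply: submodule_add => //; first exact: submodule_mul.
apply: NN' => q; rewrite (model_add mm) modelN (model_mul mm) (bigD1 r) //= big1.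
  rewrite addr0 cE eqxx -!mulrA (model_l mm) zE (model_r mm) (model_l mm) subrr.
  exact: (frame_zero frB).
by move=> u /negbTE ur; rewrite cE ur mulr0 !mul0r.
Qed.

Lemma model_rad_arrow_columns x : model_rad 1 x ->
  exists2 u : T * Ar -> A, (forall ta, arrow_column ta.1 ta.2 (u ta)) &
    x = \sum_ta u ta.
Proof.
move=> xJ; have /choice[f fE] : forall st : T * T, exists y : Ar -> B,
    phi x st.1 st.2 = \sum_a y a * el a.
  by move=> [s t]; have [y [_ yE]] := frame_left frB (xJ s t); exists y.
have /choice[u uE] : forall ta : T * Ar, exists y, forall s r, phi y s r =
    e (nu s) * (if r == ta.1 then f (s, r) ta.2 * el ta.2 else 0) * e (nu r).
  move=> ta; exact: (model_surj mm (fun s r =>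
    if r == ta.1 then f (s, r) ta.2 * el ta.2 else 0)).
exists u => [[t a]|]; first split=> [s r /eqP/negbTE nr|s].
- by rewrite uE nr mulr0 mul0r.
(* Projecting to the corner multiplies by [e (nu t)] on the right, which fixes or kills [el a]; the
   entry stays in B a. *)
- rewrite uE eqxx /= -(frame_tgt frB) -!mulrA (frame_orth frB).
  case: ifP => _; last by exists 0; rewrite !(mulr0, mul0r).
  by exists (e (nu s) * f (s, t) a); rewrite (frame_tgt frB) mulrA.
apply: (model_inj mm) => s r; rewrite model_sum.
rewrite (eq_bigr (fun p => phi (u (p.1, p.2)) s r)); last by case.
rewrite -(pair_bigA _ (fun t a => phi (u (t, a)) s r)) /= (bigD1 r) //= [X in _ + X]big1.
  rewrite addr0 -[LHS](model_l mm) -[in LHS](model_r mm) (fE (s, r)) mulrA.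
  rewrite mulr_sumr mulr_suml; apply: eq_bigr => a _.
  by rewrite uE eqxx.
move=> t nt; apply: big1 => a _.
by rewrite uE eq_sym (negbTE nt) mulr0 mul0r.
Qed.

Theorem model_multiserial : multiserial_module A^o.
Proof.
pose E : 'I_#|{: T * Ar}| -> T * Ar := enum_val.
exists #|{: T * Ar}|, (fun i => arrow_column (E i).1 (E i).2).
split=> [i||i j nij]; first exact: arrow_column_uniserial.
- apply/seteqP; split=> x.
    move=> /radical_model_rad/model_rad_arrow_columns[u uC ->].
    exists (u \o E) => [i|]; first exact: uC.
    by rewrite (reindex E) //; exists enum_rank => ta _; [apply: enum_valK | apply: enum_rankK].
  move=> [u uC ->] N maxN; apply: model_rad_maximal maxN _ => s t.
  rewrite model_sum; apply: (frame_sum frB) => i _.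
  have [ut ua] := uC i; have [->|/eqP nt] := eqVneq t (E i).1.
    have [v ->] := ua s; exact: (frame_mulr frB _ (frame_el frB _)).
  by rewrite (ut _ _ nt); apply: (frame_zero frB).
apply: arrow_columnI; rewrite -!surjective_pairing => h; apply: nij.
exact: enum_val_inj h.
Qed.

End MatrixModel.

Theorem matrix_model_multiserial (B : pzRingType) (V Ar : finType) (e : V -> B)
    (src tgt : Ar -> V) (el : Ar -> B) (nxt prv : Ar -> Ar) (J : nat -> B -> Prop)
    (A : pzRingType) (T : finType) (nu : T -> V) (phi : A -> T -> T -> B) :
  arrow_frame e src tgt el nxt prv J -> matrix_model e nu phi ->
  multiserial_algebra A.
Proof.
move=> frB mm; split; last exact: (model_multiserial frB mm).
exact: (model_multiserial (arrow_frame_converse frB) (matrix_model_converse mm)).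
Qed.

(** * Quotients of path algebras *)

Section PathDegree.
Variables (K : fieldType) (Q : quiver).
Local Notation KQ := (path_algebra K Q).
Local Notation bas := (@path_basis K Q).
Local Notation triv := (@trivial_path Q).
Implicit Types (f g : KQ) (p q : qpath Q).

Definition path_len p : nat := size (path_arrows p).

Definition deg_ge (k : nat) f : Prop := forall p, path_coef p f <> 0 -> (k <= path_len p)%N.

Lemma deg_ge_linear k c f g : deg_ge k f -> deg_ge k g -> deg_ge k (c *: f + g).
Proof.
move=> kf kg p nz; apply: contrapT => h; apply: nz.
rewrite linearP /=; have [->|/eqP/kf//] := eqVneq (path_coef p f) 0.
by have [->|/eqP/kg//] := eqVneq (path_coef p g) 0; rewrite mulr0 addr0.
Qed.

Lemma deg_ge_zero k : deg_ge k (0 : KQ).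
Proof. by move=> p; rewrite linear0. Qed.

Lemma deg_ge_basis k p : (k <= path_len p)%N -> deg_ge k (bas p).
Proof. by move=> kp q; rewrite path_coef_basis; case: eqP => [<-|]. Qed.

Lemma deg_ge_ind k (P : KQ -> Prop) :
  P 0 -> (forall c f g, P f -> P g -> P (c *: f + g)) ->
  (forall p, (k <= path_len p)%N -> P (bas p)) -> forall f, deg_ge k f -> P f.
Proof.
move=> P0 PD Pb f kf; rewrite [f]path_algebraE big_seq.
elim/big_rec: _ => // p g pf Pg; apply: PD => //; apply: Pb; apply: kf.
by apply/eqP; rewrite -path_supp_in.
Qed.

Lemma path_basis_cat p q :
  bas p * bas q = 0 \/ exists r, [/\ bas p * bas q = bas r, path_start r = path_start p,
    path_end r = path_end q & path_arrows r = path_arrows p ++ path_arrows q].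
Proof.
rewrite path_basisM; have [E|/eqP nE] := eqVneq (path_end p) (path_start q).
  by right; have [r [-> rs re ra]] := path_catP E; exists r.
by left; rewrite path_catN.
Qed.

Lemma deg_ge_mul i j f g : deg_ge i f -> deg_ge j g -> deg_ge (i + j) (f * g).
Proof.
move=> fi gj; move: f fi; apply: deg_ge_ind => [|c f f' IH IH'|p ip].
- rewrite mul0r; exact: deg_ge_zero.
- rewrite mulrDl -scalerAl; exact: deg_ge_linear.
move: g gj; apply: deg_ge_ind => [|c f f' IH IH'|q jq].
- rewrite mulr0; exact: deg_ge_zero.
- rewrite mulrDr -scalerAr; exact: deg_ge_linear.
have [->|[r [-> _ _ ra]]] := path_basis_cat p q; first exact: deg_ge_zero.
by apply: deg_ge_basis; rewrite /path_len ra size_cat leq_add.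
Qed.

Definition mk_path (v : vertex Q) s (h : composable v s) : qpath Q :=
  @exist _ (fun p : vertex Q * seq (arrow Q) => composable p.1 p.2) (v, s) h.

Lemma path_basis_consl p k : (k < path_len p)%N ->
  exists a q, (k <= path_len q)%N /\ bas p = arrow_elt K a * bas q.
Proof.
case: p => [[v [|a s]] h]; first by [].
have [/eqP av hs] : source a == v /\ composable (target a) s by apply/andP.
rewrite /path_len ltnS => ks; exists a, (mk_path hs); split=> //.
rewrite path_basisM.
have [|r [-> rs _ ra]] := @path_catP _ (arrow_path a) (mk_path hs); first by [].
by congr bas; apply: qpath_inj; rewrite ?rs ?ra.
Qed.

Lemma path_basis_consr p k : (k < path_len p)%N ->
  exists a q, (k <= path_len q)%N /\ bas p = bas q * arrow_elt K a.
Proof.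
case: p => [[v s] h]; case/lastP: s h => [|s a] h; first by [].
rewrite /path_len [path_arrows _]/= size_rcons ltnS => ks.
have [hs /eqP av] : composable v s /\ source a == last v [seq target b | b <- s].
  by move: h; rewrite [is_true _]/= -cats1 composable_cat /= andbT => /andP.
exists a, (mk_path hs); split=> //.
rewrite path_basisM.
have [|r [-> rs _ ra]] := @path_catP _ (mk_path hs) (arrow_path a).
  by rewrite /path_end /path_start /= av.
by congr bas; apply: qpath_inj; rewrite ?rs ?ra //= /path_arrows /= cats1.
Qed.

Lemma deg_ge_left k f : deg_ge k.+1 f ->
  exists y : arrow Q -> KQ, (forall a, deg_ge k (y a)) /\ f = \sum_a y a * arrow_elt K a.
Proof.
move: f; apply: deg_ge_ind => [|c f g [y [yk ->]] [z [zk ->]]|p kp].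
- exists (fun=> 0); split=> [a|]; first exact: deg_ge_zero.
  by rewrite big1 // => a _; rewrite mul0r.
- exists (fun a => c *: y a + z a); split=> [a|]; first exact: deg_ge_linear.
  rewrite scaler_sumr -big_split; apply: eq_bigr => a _ /=.
  by rewrite mulrDl scalerAl.
have [a [q [kq ->]]] := path_basis_consr kp.
exists (fun b => if b == a then bas q else 0); split=> [b|].
  by case: eqP => _; [apply: deg_ge_basis | apply: deg_ge_zero].
by rewrite (bigD1 a) //= eqxx big1 ?addr0 // => b /negbTE->; rewrite mul0r.
Qed.

Lemma deg_ge_right k f : deg_ge k.+1 f ->
  exists y : arrow Q -> KQ, (forall a, deg_ge k (y a)) /\ f = \sum_a arrow_elt K a * y a.
Proof.
move: f; apply: deg_ge_ind => [|c f g [y [yk ->]] [z [zk ->]]|p kp].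
- exists (fun=> 0); split=> [a|]; first exact: deg_ge_zero.
  by rewrite big1 // => a _; rewrite mulr0.
- exists (fun a => c *: y a + z a); split=> [a|]; first exact: deg_ge_linear.
  rewrite scaler_sumr -big_split; apply: eq_bigr => a _ /=.
  by rewrite mulrDr scalerAr.
have [a [q [kq ->]]] := path_basis_consl kp.
exists (fun b => if b == a then bas q else 0); split=> [b|].
  by case: eqP => _; [apply: deg_ge_basis | apply: deg_ge_zero].
by rewrite (bigD1 a) //= eqxx big1 ?addr0 // => b /negbTE->; rewrite mulr0.
Qed.

Lemma ideal_scale (I : set KQ) c f : ideal I -> I f -> I (c *: f).
Proof. by case=> _ _ IM If; rewrite -[f]mul1r scalerAl; apply: (IM _ _ If).1. Qed.

Lemma ideal_gen_ideal (R : pzRingType) (S : set R) : ideal (ideal_gen S).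
Proof.
split=> [I [I0 _ _] _ //|x y xS yS I IP SI|a x xS].
  by case: (IP) => _ ID _; apply: ID; [apply: xS | apply: yS].
by split=> I IP SI; case: (IP) => _ _ IM; have [] := IM a x (xS I IP SI).
Qed.

Lemma ideal_exp_ideal (R : pzRingType) (I : set R) n : ideal (ideal_exp I n).
Proof. by case: n => [|n]; [split | apply: ideal_gen_ideal]. Qed.

(** Through this inclusion, admissibility makes the filtration of B by path length nilpotent. *)
Lemma deg_ge_ideal_exp k f : deg_ge k f -> ideal_exp (@arrow_ideal K Q) k f.
Proof.
elim: k f => [|k IH] // f; apply: deg_ge_ind => [|c g h Ig Ih|p kp].
- by case: (ideal_exp_ideal (@arrow_ideal K Q) k.+1).
- case: (ideal_exp_ideal (@arrow_ideal K Q) k.+1) => _ ID _; apply: ID => //.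
  exact: (ideal_scale c (ideal_exp_ideal (@arrow_ideal K Q) k.+1) Ig).
have [a [q [kq ->]]] := path_basis_consl kp.
move=> I _ SI; apply: SI; exists (arrow_elt K a), (bas q); split=> //.
  by move=> I' _ SI; apply: SI; exists a.
exact/IH/deg_ge_basis.
Qed.

Lemma vertex_basis_mul v p : bas (triv v) * bas p = if v == path_start p then bas p else 0.
Proof. by rewrite path_basisM trivial_path_cat; case: eqP. Qed.

Lemma mul_vertex_basis v p : bas p * bas (triv v) = if path_end p == v then bas p else 0.
Proof. by rewrite path_basisM path_cat_trivial; case: eqP. Qed.

Lemma path_len0 p : path_len p = 0%N -> p = triv (path_start p).
Proof. by move=> /size0nil pn; apply: qpath_inj. Qed.

Lemma deg_ge_off v w f : v <> w -> deg_ge 1 (bas (triv v) * f * bas (triv w)).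
Proof.
move=> nvw; have : deg_ge 0 f by [].
move: f; apply: deg_ge_ind => [|c f g IH IH'|p _].
- rewrite mulr0 mul0r; exact: deg_ge_zero.
- rewrite mulrDr mulrDl -scalerAr -scalerAl; exact: deg_ge_linear.
rewrite vertex_basis_mul; case: eqP => [vp|]; last by rewrite mul0r => _; apply: deg_ge_zero.
rewrite mul_vertex_basis; case: eqP => [wp|]; last by move=> _; apply: deg_ge_zero.
apply: deg_ge_basis; rewrite lt0n; apply/eqP => /path_len0 pE.
by apply: nvw; rewrite vp -wp pE.
Qed.

(** A character of the path algebra ([vertex_coef_mul]), the residue at [v]. *)
Definition vertex_coef v f : K := path_coef (triv v) f.

Lemma deg_ge_vertex_coef f : deg_ge 1 (f - \sum_v vertex_coef v f *: bas (triv v)).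
Proof.
have : deg_ge 0 f by [].
move: f; apply: deg_ge_ind => [|c f g IH IH'|p _].
- rewrite big1 ?subr0; first exact: deg_ge_zero.
  by move=> v _; rewrite /vertex_coef linear0 scale0r.
- have -> : \sum_v vertex_coef v (c *: f + g) *: bas (triv v) =
    c *: \sum_v vertex_coef v f *: bas (triv v) + \sum_v vertex_coef v g *: bas (triv v).
    rewrite scaler_sumr -big_split; apply: eq_bigr => v _ /=.
    by rewrite /vertex_coef linearP scalerDl scalerA.
  rewrite opprD addrACA -scalerBr; exact: deg_ge_linear.
have [p0|p1] := posnP (path_len p).
  rewrite (path_len0 p0) (bigD1 (path_start p)) //= big1 => [|v nv]; last first.
    rewrite /vertex_coef path_coef_basis; case: eqP; last by rewrite scale0r.
    by move=> /(congr1 (@path_start Q)) E; move: nv; rewrite -[v]/(path_start (triv v)) -E eqxx.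
  by rewrite /vertex_coef path_coef_basis eqxx scale1r addr0 subrr; apply: deg_ge_zero.
rewrite big1 ?subr0; first exact: deg_ge_basis.
by move=> v _; rewrite /vertex_coef path_coef_basis; case: eqP p1 => [->|]; rewrite ?scale0r.
Qed.

Lemma vertex_coef_linear v c f g :
  vertex_coef v (c *: f + g) = c * vertex_coef v f + vertex_coef v g.
Proof. exact: linearP. Qed.

Lemma vertex_coef_deg v f : deg_ge 1 f -> vertex_coef v f = 0.
Proof. by move=> f1; apply: contrapT => /f1. Qed.

(** A product of two paths is trivial only if both factors are. *)
Lemma vertex_coef_mul v f g : vertex_coef v (f * g) = vertex_coef v f * vertex_coef v g.
Proof.
have vertex_coef0 : vertex_coef v 0 = 0 by apply: linear0.
move: f g; apply: path_algebra_ind => [g|c f f' IH IH' g|p].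
- by rewrite mul0r vertex_coef0 mul0r.
- by rewrite mulrDl -scalerAl !vertex_coef_linear IH IH' mulrDl mulrA.
apply: path_algebra_ind => [|c f f' IH IH'|q].
- by rewrite mulr0 vertex_coef0 mulr0.
- by rewrite mulrDr -scalerAr !vertex_coef_linear IH IH' mulrDr mulrCA.
have [p0|p1] := posnP (path_len p); last first.
  rewrite (vertex_coef_deg v (deg_ge_basis p1)) mul0r vertex_coef_deg //.
  by rewrite -[1%N]addn0; apply: deg_ge_mul => //; apply: deg_ge_basis.
rewrite (path_len0 p0) vertex_basis_mul /vertex_coef !fun_if !path_coef_basis linear0.
have [Eq|] := eqVneq q (triv v); last by rewrite mulr0 if_same.
rewrite Eq [path_start _]/= mulr1; case: eqP => [->|nE]; first by rewrite eqxx.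
by case: eqP => // /(congr1 (@path_start Q)).
Qed.

End PathDegree.

(** * KQ/I as an arrow frame *)

Section PathAlgebraQuotient.
Variables (K : fieldType) (Q : quiver) (I : set (path_algebra K Q)).
Hypotheses (admI : admissible I) (condM : condition_M I).
Variables (B : algType K) (pi : {lrmorphism path_algebra K Q -> B}).
Hypotheses (pi_surj : forall b, exists f, pi f = b) (pi_ker : forall f, pi f = 0 <-> I f).
Local Notation KQ := (path_algebra K Q).
Local Notation bas := (@path_basis K Q).
Local Notation triv := (@trivial_path Q).

Definition quot_deg (k : nat) (b : B) : Prop := exists2 f, deg_ge k f & pi f = b.
Definition quot_vertex (v : vertex Q) : B := pi (bas (triv v)).
Definition quot_arrow (a : arrow Q) : B := pi (arrow_elt K a).

(** Elements of positive degree form an ideal containing the arrows, hence containing [I]. So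
    residues are well defined on B, and an idempotent matrix over B has idempotent residues over
    K. *)
Lemma vertex_coef_ideal v f : I f -> vertex_coef v f = 0.
Proof.
case: admI => _ II2 _ /II2 h.
have sub (S : set KQ) : (forall x, S x -> deg_ge 1 x) ->
    forall x, ideal_gen S x -> deg_ge 1 x.
  move=> S1 x; apply=> //; split=> [|y z|y z z1]; first exact: deg_ge_zero.
    by move=> y1 z1; rewrite -[y]scale1r; apply: deg_ge_linear.
  have y0 : deg_ge 0 y by [].
  by split; [rewrite -[1%N]add0n | rewrite -[1%N]addn0]; apply: deg_ge_mul.
apply: vertex_coef_deg; apply: (sub _ _ _ h) => _ [x [y [x1 _ ->]]].
rewrite -[1%N]addn0; apply: deg_ge_mul => //.
by apply: (sub _ _ _ x1) => _ [a _ <-]; apply: deg_ge_basis.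
Qed.

Lemma quot_arrow_neq0 a b : quot_arrow a * quot_arrow b <> 0 ->
  ~ I (arrow_elt K a * arrow_elt K b).
Proof. by rewrite -rmorphM => nz /pi_ker. Qed.

Theorem quotient_arrow_frame : exists nxt prv : arrow Q -> arrow Q,
  arrow_frame quot_vertex (@source Q) (@target Q) quot_arrow nxt prv quot_deg.
Proof.
have /choice[nxt nxtP] : forall a, exists b, forall b',
    quot_arrow a * quot_arrow b' <> 0 -> b = b'.
  move=> a; have [[b ab]|h] := pselect (exists b, quot_arrow a * quot_arrow b <> 0).
    exists b => b' ab'; apply: (condM a).1; exact: quot_arrow_neq0.
  (* No arrow follows [a]: any value will do. *)
  by exists a => b' ab'; case: h; exists b'.
have /choice[prv prvP] : forall a, exists b, forall b',
    quot_arrow b' * quot_arrow a <> 0 -> b = b'.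
  move=> a; have [[b ab]|h] := pselect (exists b, quot_arrow b * quot_arrow a <> 0).
    exists b => b' ab'; apply: (condM a).2; exact: quot_arrow_neq0.
  by exists a => b' ab'; case: h; exists b'.
exists nxt, prv; split.
- by rewrite -(rmorph1 pi) path_algebra_oneE rmorph_sum.
- move=> v w; rewrite -rmorphM vertex_basis_mul -[path_start _]/w.
  by case: eqP => [->//|_]; rewrite rmorph0.
- by move=> a; rewrite -rmorphM vertex_basis_mul eqxx.
- by move=> a; rewrite -rmorphM mul_vertex_basis eqxx.
- by move=> a b ab; split; [apply: nxtP | apply: prvP].
- by move=> a; exists (arrow_elt K a) => //; apply: deg_ge_basis.
- by move=> x; have [f <-] := pi_surj x; exists f.
- case: admI => _ _ [m _ Jm]; exists m => _ [f fm <-]; apply/pi_ker/Jm.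
  exact: deg_ge_ideal_exp.
- by move=> k; exists 0; [apply: deg_ge_zero | rewrite rmorph0].
- move=> k _ _ [f fk <-] [g gk <-]; exists (f + g); last by rewrite rmorphD.
  by rewrite -[f]scale1r; apply: deg_ge_linear.
- move=> i j _ _ [f fi <-] [g gj <-]; exists (f * g); last by rewrite rmorphM.
  exact: deg_ge_mul.
- move=> k _ [f /deg_ge_left[y [yk ->]] <-].
  exists (pi \o y); split=> [a|]; first by exists (y a).
  by rewrite rmorph_sum; apply: eq_bigr => a _; rewrite rmorphM.
- move=> k _ [f /deg_ge_right[y [yk ->]] <-].
  exists (pi \o y); split=> [a|]; first by exists (y a).
  by rewrite rmorph_sum; apply: eq_bigr => a _; rewrite rmorphM.
- move=> v w x nvw; have [f <-] := pi_surj x; rewrite -!rmorphM.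
  by exists (bas (triv v) * f * bas (triv w)) => //; apply: deg_ge_off.
move=> v x; have [f <-] := pi_surj x.
have h : quot_deg 1 (quot_vertex v * pi f * quot_vertex v -
    (vertex_coef v f)%:A * quot_vertex v).
  exists (bas (triv v) * (f - \sum_w vertex_coef w f *: bas (triv w)) * bas (triv v)).
    rewrite -[1%N]add0n -[(0 + 1)%N]addn0; apply: deg_ge_mul => //.
    by apply: deg_ge_mul => //; apply: deg_ge_vertex_coef.
  rewrite mulrBr mulrBl mulr_sumr (bigD1 v) //= big1 => [|w nw].
    rewrite addr0 -scalerAr -scalerAl !(vertex_basis_mul, eqxx).
    by rewrite linearB /= linearZ /= !rmorphM mulr_algl.
  by rewrite -scalerAr vertex_basis_mul eq_sym (negbTE nw) scaler0.
have [c0|c0] := eqVneq (vertex_coef v f) 0.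
  by left; move: h; rewrite c0 scale0r mul0r subr0.
right; exists (vertex_coef v f)%:A, (vertex_coef v f)^-1%:A; split=> //.
  by move=> y; rewrite mulr_algl mulr_algr.
by rewrite mulr_algl scalerA mulfV // scale1r.
Qed.

End PathAlgebraQuotient.

(** * Diagonalization of idempotent matrices *)

Section LiftEquivalence.
Variables (B : pzRingType) (V Ar : finType) (e : V -> B) (src tgt : Ar -> V).
Variables (el : Ar -> B) (nxt prv : Ar -> Ar) (J : nat -> B -> Prop).
Hypothesis frB : arrow_frame e src tgt el nxt prv J.

Definition mx_rad (k : nat) m n (M : 'M[B]_(m, n)) : Prop := forall i j, J k (M i j).

Lemma mx_rad_mul i j m n p (M : 'M_(m, n)) (N : 'M_(n, p)) :
  mx_rad i M -> mx_rad j N -> mx_rad (i + j) (M *m N).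
Proof.
move=> Mi Nj s t; rewrite mxE; apply: (frame_sum frB) => r _; exact: (frame_mul frB).
Qed.

Lemma mx_rad_mull k m n p (M : 'M_(m, n)) (N : 'M_(n, p)) :
  mx_rad k M -> mx_rad k (M *m N).
Proof.
by move=> Mk; rewrite -[k]addn0; apply: mx_rad_mul => // s t; apply: (frame_J0 frB).
Qed.

Lemma mx_rad_mulr k m n p (M : 'M_(m, n)) (N : 'M_(n, p)) :
  mx_rad k N -> mx_rad k (M *m N).
Proof.
by move=> Nk; rewrite -[k]add0n; apply: mx_rad_mul => // s t; apply: (frame_J0 frB).
Qed.

Lemma mx_rad_add k m n (M N : 'M_(m, n)) : mx_rad k M -> mx_rad k N -> mx_rad k (M + N).
Proof. by move=> Mk Nk i j; rewrite mxE; apply: (frame_add frB). Qed.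

Lemma mx_rad_nil m n : exists k, forall M : 'M_(m, n), mx_rad k M -> M = 0.
Proof.
have [k k0] := frame_nil frB; exists k => M Mk; apply/matrixP => i j.
by rewrite mxE; apply: k0.
Qed.

Lemma mx_rad_geometric n (N : 'M_n) : mx_rad 1 N -> exists g, (1%:M + N) *m g = 1%:M.
Proof.
move=> N1; have [k k0] := mx_rad_nil n n.
suff [g [r [rk gE]]] : exists g r, mx_rad k r /\ (1%:M + N) *m g = 1%:M + r.
  by exists g; rewrite gE (k0 _ rk) addr0.
elim: k {k0} => [|k [g [r [rk gE]]]].
  exists 0, (- 1%:M); split; last by rewrite mulmx0 subrr.
  by move=> i j; apply: (frame_J0 frB).
exists (g - r), (- N *m r); split.
  rewrite -add1n; apply: mx_rad_mul => // i j; rewrite mxE; exact: (frame_opp frB).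
by rewrite mulmxBr gE mulmxDl mul1mx opprD addrA addrK mulNmx.
Qed.

Lemma mx_rad_idem n (h : 'M_n) : h *m h = h -> mx_rad 1 h -> h = 0.
Proof.
move=> hh h1; have [k k0] := mx_rad_nil n n; apply: k0.
elim: k => [|k IH]; first by move=> i j; apply: (frame_J0 frB).
by rewrite -hh -add1n; apply: mx_rad_mul.
Qed.

(** [N] is the defect of [Y0 *m E *m X0] from [D]. The inverse [g] of [1%:M + N] corrects it, so
    [Y *m X] is exactly [D]. Then [E - X *m Y] is an idempotent with entries in the nilpotent
    radical, hence 0. *)
Lemma lift_idempotent_equivalence n k (E : 'M_n) (D : 'M_k) X0 Y0 :
  E *m E = E -> D *m D = D -> Y0 *m X0 = D -> X0 *m D = X0 -> D *m Y0 = Y0 ->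
  mx_rad 1 (E - X0 *m Y0) -> exists X Y, X *m Y = E /\ Y *m X = D.
Proof.
move=> EE DD YX XD DY EJ.
set N := Y0 *m (E - X0 *m Y0) *m X0.
have NJ : mx_rad 1 N by apply/mx_rad_mull/mx_rad_mulr.
have NE : Y0 *m E *m X0 = D + N.
  by rewrite /N mulmxBr mulmxBl !mulmxA YX -(mulmxA D) YX DD addrC subrK.
have DN : D *m N = N by rewrite /N !mulmxA DY.
clearbody N; have [g gE] := mx_rad_geometric NJ.
pose X := E *m X0 *m g *m D; pose Y := Y0 *m E.
have YXD : Y *m X = D.
  have -> : Y *m X = (D *m (1%:M + N)) *m g *m D.
    by rewrite mulmxDr mulmx1 DN -NE /X /Y !mulmxA -(mulmxA Y0) EE.
  by rewrite -(mulmxA D) gE mulmx1 DD.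
exists X, Y; split=> //; apply/eqP; rewrite -subr_eq0 -oppr_eq0 opprB; apply/eqP.
have XYE : X *m Y *m E = X *m Y by rewrite /Y -!mulmxA EE.
have EXY : E *m (X *m Y) = X *m Y by rewrite /X !mulmxA EE.
have XYXY : X *m Y *m (X *m Y) = X *m Y.
  by rewrite mulmxA -(mulmxA X) YXD /X -[_ *m D *m D]mulmxA DD.
apply: mx_rad_idem.
  by rewrite mulmxBl !mulmxBr EE XYE EXY XYXY subrr subr0.
have gN : g = 1%:M - N *m g by rewrite -gE mulmxDl mul1mx addrK.
have -> : E - X *m Y = E *m (E - X0 *m Y0) *m E + E *m X0 *m (N *m g) *m Y0 *m E.
  rewrite /X /Y !mulmxA -(mulmxA _ D) DY {1}gN !(mulmxBr, mulmxBl) !mulmxA mulmx1 !EE.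
  by rewrite opprB addrA addrAC.
apply: mx_rad_add; first exact/mx_rad_mull/mx_rad_mulr.
by do 2!apply: mx_rad_mull; apply: mx_rad_mulr; apply: mx_rad_mull.
Qed.

End LiftEquivalence.

(** With [E = C R] a rank factorization, [C] cancels on the left and [R] on the right in
    [C R C R = C R]. *)
Lemma idempotent_base (K : fieldType) n (E : 'M[K]_n) : E *m E = E ->
  row_base E *m col_base E = 1%:M.
Proof.
have aux r (R : 'M[K]_(r, n)) (C : 'M_(n, r)) (R' : 'M_(n, r)) (C' : 'M_(r, n)) :
    R *m R' = 1%:M -> C' *m C = 1%:M -> C *m R *m (C *m R) = C *m R -> R *m C = 1%:M.
  move=> RR CC CRCR; have := congr1 (fun M => C' *m M *m R') CRCR.
  by rewrite /= !mulmxA CC !mul1mx -!mulmxA RR !mulmx1.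
have /row_freeP[R' RR] := row_base_free E.
have /row_fullP[C' CC] := col_base_full E.
by move=> EE; apply: aux RR CC _; rewrite mulmx_base.
Qed.

Section IdempotentModel.
Variables (K : fieldType) (Q : quiver) (I : set (path_algebra K Q)).
Hypotheses (admI : admissible I) (condM : condition_M I).
Variables (B : algType K) (pi : {lrmorphism path_algebra K Q -> B}).
Hypotheses (pi_surj : forall b, exists f, pi f = b) (pi_ker : forall f, pi f = 0 <-> I f).
Local Notation KQ := (path_algebra K Q).
Local Notation qv := (quot_vertex pi).

(* Modulo the radical, an idempotent matrix over B is a family of idempotent
   matrices over K, one for each vertex; rank factorizations diagonalize them. *)
Lemma idempotent_vertex_coef n (E : 'M[B]_n) : E *m E = E ->
  exists F : vertex Q -> 'M[K]_n, (forall v, F v *m F v = F v) /\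
    forall i j, quot_deg pi 1 (E i j - \sum_v F v i j *: qv v).
Proof.
move=> EE; have /choice[f fE] : forall ij : 'I_n * 'I_n, exists f, pi f = E ij.1 ij.2.
  by move=> ij; apply: pi_surj.
exists (fun v => \matrix_(i, j) vertex_coef v (f (i, j))); split=> [v|i j].
  apply/matrixP => i j; rewrite !mxE.
  pose lin : {linear KQ -> K | *%R} := path_coef (trivial_path v).
  have -> : vertex_coef v (f (i, j)) = vertex_coef v (\sum_k f (i, k) * f (k, j)).
    apply/eqP; rewrite -subr_eq0 -[_ - _](linearB lin); apply/eqP.
    apply: (vertex_coef_ideal admI); apply/pi_ker.
    rewrite linearB linear_sum /= fE /= -{1}EE mxE; apply/eqP; rewrite subr_eq0; apply/eqP.
    apply: eq_bigr => k _.
    exact: esym (etrans (rmorphM pi _ _) (congr2 *%R (fE (i, k)) (fE (k, j)))).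
  rewrite -[RHS]/(lin _) linear_sum; apply: eq_bigr => k _.
  by rewrite !mxE -vertex_coef_mul.
exists (f (i, j) - \sum_v vertex_coef v (f (i, j)) *: path_basis K (trivial_path v)).
  exact: deg_ge_vertex_coef.
rewrite linearB linear_sum /= fE; congr (_ - _); apply: eq_bigr => v _.
by rewrite linearZ mxE.
Qed.

Definition vertex_diag k (nu : 'I_k -> vertex Q) : 'M[B]_k :=
  \matrix_(s, t) if s == t then qv (nu s) else 0.

Lemma idempotent_diagonal n (E : 'M[B]_n) : E *m E = E ->
  exists k (nu : 'I_k -> vertex Q) (X : 'M_(n, k)) (Y : 'M_(k, n)),
    X *m Y = E /\ Y *m X = vertex_diag nu.
Proof.
move=> EE; have [F [FF FE]] := idempotent_vertex_coef EE.
have [nxt [prv fr]] := quotient_arrow_frame admI condM pi_surj pi_ker.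
(* One index for each vertex [v] and each row of [row_base (F v)]. Orthogonality of the [qv v] keeps
   the vertices apart: [Y1 X1] is exactly diagonal, whereas [X1 Y1] equals [E] only modulo the
   radical. *)
pose S : finType := {v : vertex Q & 'I_(\rank (F v))}.
pose X1 i (u : S) : B := col_base (F (tag u)) i (tagged u) *: qv (tag u).
pose Y1 (u : S) j : B := row_base (F (tag u)) (tagged u) j *: qv (tag u).
have qvv v w : qv v * qv w = if v == w then qv v else 0 := frame_orth fr v w.
have YX1 u u' : \sum_j Y1 u j * X1 j u' = if u == u' then qv (tag u) else 0.
  case: u u' => [v k] [w l]; rewrite /X1 /Y1 /=.
  have [Evw|nvw] := eqVneq v w; last first.
    rewrite big1 => [|j _]; last by rewrite -scalerAl -scalerAr qvv (negbTE nvw) !scaler0.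
    by case: eqP => // /(congr1 tag) /= /eqP; rewrite (negbTE nvw).
  case: w / Evw l => l.
  have -> : (Tagged (fun v => 'I_(\rank (F v))) k == Tagged (fun v => 'I_(\rank (F v))) l)
     = (k == l) by rewrite eq_Tagged.
  have := idempotent_base (FF v) => /matrixP/(_ k l); rewrite !mxE => h.
  transitivity ((k == l)%:R *: qv v); last by case: eqP; rewrite ?scale1r ?scale0r.
  rewrite -h scaler_suml; apply: eq_bigr => j _.
  by rewrite -scalerAl -scalerAr qvv eqxx scalerA.
have XY1 i j : \sum_u X1 i u * Y1 u j = \sum_v F v i j *: qv v.
  transitivity (\sum_v \sum_(k < \rank (F v))
      X1 i (Tagged (fun v => 'I_(\rank (F v))) k) *
      Y1 (Tagged (fun v => 'I_(\rank (F v))) k) j).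
    by rewrite sig_big_dep /=; apply: eq_bigr => -[v k].
  apply: eq_bigr => v _; rewrite -[in RHS](mulmx_base (F v)) mxE scaler_suml.
  by apply: eq_bigr => k _; rewrite /X1 /Y1 /= -scalerAl -scalerAr qvv eqxx scalerA.
pose nu (t : 'I_#|S|) := tag (enum_val t).
have Dl (t : 'I_#|S|) (f : 'I_#|S| -> B) :
    \sum_s vertex_diag nu t s * f s = qv (nu t) * f t.
  rewrite (bigD1 t) //= mxE eqxx big1 ?addr0 // => s ns.
  by rewrite mxE eq_sym (negbTE ns) mul0r.
have Dr (t : 'I_#|S|) (f : 'I_#|S| -> B) :
    \sum_s f s * vertex_diag nu s t = f t * qv (nu t).
  rewrite (bigD1 t) //= mxE eqxx big1 ?addr0 // => s ns.
  by rewrite mxE (negbTE ns) mulr0.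
exists #|S|, nu.
apply: (lift_idempotent_equivalence fr (X0 := \matrix_(i, t) X1 i (enum_val t))
  (Y0 := \matrix_(t, j) Y1 (enum_val t) j)) => //.
- by apply/matrixP => s t; rewrite mxE Dl !mxE; case: eqP; rewrite ?mulr0 ?qvv ?eqxx.
- apply/matrixP => s t; rewrite !mxE; under eq_bigr do rewrite !mxE.
  by rewrite YX1 (inj_eq enum_val_inj).
- apply/matrixP => i t; rewrite mxE Dr !mxE.
  by rewrite /X1 -scalerAl qvv eqxx.
- apply/matrixP => t j; rewrite mxE Dl !mxE.
  by rewrite /Y1 -scalerAr qvv eqxx.
move=> i j; rewrite mxE [X in _ + X]mxE; have := FE i j.
congr (quot_deg pi 1 (_ - _)); rewrite -XY1 mxE (reindex (enum_val : 'I_#|S| -> S)) /=.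
  by apply: eq_bigr => t _; rewrite !mxE.
by exists enum_rank => u _; [apply: enum_valK | apply: enum_rankK].
Qed.

(* [phi0] identifies A with the corner E M_n(B) E. *)
Theorem corner_multiserial (A : pzRingType) n (E : 'M[B]_n) (phi0 : A -> 'M[B]_n) :
  (forall x y, phi0 (x + y) = phi0 x + phi0 y) ->
  (forall x y, phi0 (x * y) = phi0 x *m phi0 y) ->
  injective phi0 -> phi0 1 = E ->
  (forall M, exists x, phi0 x = E *m M *m E) ->
  multiserial_algebra A.
Proof.
move=> phiD phiM phi_inj phi1 phi_surj.
have EE : E *m E = E by rewrite -phi1 -phiM mulr1.
have phil x : E *m phi0 x = phi0 x by rewrite -phi1 -phiM mul1r.
have phir x : phi0 x *m E = phi0 x by rewrite -phi1 -phiM mulr1.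
have [nxt [prv fr]] := quotient_arrow_frame admI condM pi_surj pi_ker.
have [k [nu [X [Y [XY YX]]]]] := idempotent_diagonal EE.
have Dl (M : 'M_k) s t : (vertex_diag nu *m M) s t = qv (nu s) * M s t.
  rewrite mxE (bigD1 s) //= mxE eqxx big1 ?addr0 // => r nr.
  by rewrite mxE eq_sym (negbTE nr) mul0r.
have Dr (M : 'M_k) s t : (M *m vertex_diag nu) s t = M s t * qv (nu t).
  rewrite mxE (bigD1 t) //= mxE eqxx big1 ?addr0 // => r nr.
  by rewrite mxE (negbTE nr) mulr0.
have DY x : vertex_diag nu *m (Y *m phi0 x *m X) = Y *m phi0 x *m X.
  by rewrite -YX !mulmxA -(mulmxA Y X Y) XY -(mulmxA Y E) phil.
have DX x : (Y *m phi0 x *m X) *m vertex_diag nu = Y *m phi0 x *m X.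
  by rewrite -YX -!mulmxA (mulmxA X Y X) XY (mulmxA (phi0 x)) phir.
have phiE x : phi0 x = X *m (Y *m phi0 x *m X) *m Y.
  by rewrite !mulmxA XY phil -mulmxA XY phir.
have YEX : Y *m E *m X = vertex_diag nu.
  have DD : vertex_diag nu *m vertex_diag nu = vertex_diag nu.
    apply/matrixP => s t; rewrite Dl mxE; case: eqP => _; rewrite ?mulr0 //.
    exact: (frame_idem fr).
  by rewrite -XY !mulmxA YX -mulmxA YX DD.
(* From [X *m Y = E] and [Y *m X = vertex_diag nu], sending [M] to [Y *m M *m X] identifies the two
   corners. *)
apply: (matrix_model_multiserial fr (nu := nu)
  (phi := fun x s t => (Y *m phi0 x *m X) s t)).
split=> [x y s t|x y s t|x s t|x s t|x y h|M].
- by rewrite phiD mulmxDr mulmxDl mxE.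
- have -> : Y *m phi0 (x * y) *m X = (Y *m phi0 x *m X) *m (Y *m phi0 y *m X).
    by rewrite phiM !mulmxA -[_ *m X *m Y]mulmxA XY -[_ *m phi0 x *m E]mulmxA phir.
  by rewrite mxE.
- by rewrite -Dl DY.
- by rewrite -Dr DX.
- apply: phi_inj; rewrite (phiE x) (phiE y); congr (X *m _ *m Y).
  exact/matrixP.
have [x xE] := phi_surj (X *m (\matrix_(s, t) M s t) *m Y).
exists x => s t; rewrite xE.
have -> : Y *m (E *m (X *m (\matrix_(s, t) M s t) *m Y) *m E) *m X =
    Y *m E *m X *m (\matrix_(s, t) M s t) *m (Y *m E *m X) by rewrite !mulmxA.
by rewrite YEX Dr Dl mxE.
Qed.

End IdempotentModel.
(** * Morita equivalence *)

Definition pack_linear (R : pzRingType) (U V : lmodType R) (f : U -> V)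
  (fL : linear f) : {linear U -> V} := HB.pack f (GRing.isLinear.Build R U V *:%R f fL).

(** * Submodules as modules, to which functors apply *)

Section SubmoduleType.
Variables (R : pzRingType) (U : lmodType R) (N : set U) (sN : submodule N).

Definition submodule_pred (_ : submodule N) : {pred U} := fun x => `[<N x>].

Lemma submodule_pred_closed : submod_closed (submodule_pred sN).
Proof.
split=> [|a x y /asboolP Nx /asboolP Ny]; apply/asboolP; first by case: sN.
exact: sN.2.
Qed.

HB.instance Definition _ := GRing.isSubmodClosed.Build R U (submodule_pred sN)
  (GRing.submod_closed_semi submodule_pred_closed).

Inductive submodule_type := Submodule x & x \in submodule_pred sN.
Definition submodule_val (u : submodule_type) : U := let: Submodule x _ := u in x.

HB.instance Definition _ := [isSub for submodule_val].
HB.instance Definition _ := [Choice of submodule_type by <:].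
HB.instance Definition _ := [SubChoice_isSubLmodule of submodule_type by <:].

Lemma submodule_valP (u : submodule_type) : N (val u).
Proof. exact/asboolP/(valP u). Qed.

Definition submodule_incl : {linear submodule_type -> U} := val.

Lemma submodule_lift (V : lmodType R) (f : {linear V -> U}) :
  (forall v, N (f v)) -> exists g : {linear V -> submodule_type},
    forall v, submodule_incl (g v) = f v.
Proof.
move=> fN; have fP v : f v \in submodule_pred sN by apply/asboolP.
pose g v := Submodule (fP v).
have gL : linear g.
  move=> a x y; apply: val_inj.
  exact: etrans (linearP f a x y) (esym (linearP submodule_incl a (g x) (g y))).
by exists (pack_linear gL).
Qed.

End SubmoduleType.

(** * What an equivalence of module categories preserves *)

Section Equivalence.
Variables (R S : pzRingType) (F : module_functor R S) (G : module_functor S R).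
Variables (eta : forall U : lmodType R, {linear G (F U) -> U}).
Hypothesis eta_bij : forall U : lmodType R, bijective (eta U).
Hypothesis eta_nat : forall (U V : lmodType R) (f : {linear U -> V}),
  eta V \o fmor G (fmor F f) =1 f \o eta U.
Variables (eps : forall U : lmodType S, {linear F (G U) -> U}).
Hypothesis eps_bij : forall U : lmodType S, bijective (eps U).
Hypothesis eps_nat : forall (U V : lmodType S) (f : {linear U -> V}),
  eps V \o fmor F (fmor G f) =1 f \o eps U.

Lemma fmor_compE (U V W : lmodType R) (k : {linear V -> W}) (l : {linear U -> V}) x :
  fmor F k (fmor F l x) = fmor F (k \o l : {linear U -> W}) x.
Proof. exact: esym (fmor_comp k l x). Qed.

Lemma fmor_faithful (U V : lmodType R) (f g : {linear U -> V}) :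
  fmor F f =1 fmor F g -> f =1 g.
Proof.
move=> fg u; have [eta' _ etaK] := eta_bij U; rewrite -(etaK u).
by rewrite -[f _]eta_nat -[g _]eta_nat /=; congr (eta V _); apply: fmor_ext.
Qed.

Lemma fmor_faithful_inv (U V : lmodType S) (f g : {linear U -> V}) :
  fmor G f =1 fmor G g -> f =1 g.
Proof.
move=> fg u; have [eps' _ epsK] := eps_bij U; rewrite -(epsK u).
by rewrite -[f _]eps_nat -[g _]eps_nat /=; congr (eps V _); apply: fmor_ext.
Qed.

(** Transport [h] along [eta]: naturality gives [G (F h') = G h], and G is faithful. *)
Lemma fmor_full (U V : lmodType R) (h : {linear F U -> F V}) :
  exists h' : {linear U -> V}, fmor F h' =1 h.
Proof.
have [eta' etaK etaK'] := eta_bij U.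
have eta'L : linear eta'.
  by move=> a x y; apply: (bij_inj (eta_bij U)); rewrite linearP !etaK'.
pose h' : {linear U -> V} := eta V \o fmor G h \o pack_linear eta'L.
exists h'; apply: fmor_faithful_inv => z; apply: (bij_inj (eta_bij V)).
by have := eta_nat h' z; rewrite /= etaK.
Qed.

Lemma fmor_lift (W : lmodType S) (V : lmodType R) (h : {linear W -> F V}) :
  exists h' : {linear G W -> V}, forall z, fmor F h' z = h (eps W z).
Proof. by have [h' hE] := fmor_full (h \o eps W); exists h'. Qed.

Definition element_map (T : pzRingType) (M : lmodType T) (x : M) : T^o -> M :=
  fun a => (a : T) *: x.

Lemma element_map_linear (T : pzRingType) (M : lmodType T) (x : M) :
  linear (element_map x).
Proof. by move=> a b c; rewrite /element_map scalerDl -scalerA. Qed.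

(** An element of [F U] is a map from S to [F U], hence comes from a map from [G S] to [U], and
    there joint injectivity applies. *)
Lemma fmor_jointly_injective (I : Type) (U : lmodType R) (V : I -> lmodType R)
    (f : forall i, {linear U -> V i}) :
  (forall x y, (forall i, f i x = f i y) -> x = y) ->
  forall x y, (forall i, fmor F (f i) x = fmor F (f i) y) -> x = y.
Proof.
move=> f_inj x y xy.
have [gx gxE] := fmor_lift (pack_linear (element_map_linear x)).
have [gy gyE] := fmor_lift (pack_linear (element_map_linear y)).
have gxy : gx =1 gy.
  move=> z; apply: f_inj => i.
  have := @fmor_faithful _ _ (f i \o gx) (f i \o gy); apply=> w.
  rewrite (fmor_comp (f i) gx) (fmor_comp (f i) gy) /= gxE gyE.
  by rewrite /pack_linear /= /element_map !linearZ xy.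
have [eps' _ epsK] := eps_bij S^o.
have := fmor_ext (m := F) gxy (eps' 1); rewrite gxE gyE epsK.
by rewrite /pack_linear /= /element_map !scale1r.
Qed.

(** Fullness provides [g] with [F g = 0], and [f] equals [f \o g] since both vanish. *)
Lemma fmor_zero (U V : lmodType R) (f : {linear U -> V}) : f =1 (fun=> 0) ->
  forall x, fmor F f x = 0.
Proof.
move=> f0 x; have [g gE] := fmor_full (\0 : {linear F U -> F U}).
have fg : f =1 f \o g by move=> u; rewrite /= !f0.
by rewrite (fmor_ext fg) fmor_comp /= gE linear0.
Qed.

(* The sum is recovered from f and g through the biproduct V x V, which F
   preserves because it preserves jointly injective families. *)
Lemma fmor_add (U V : lmodType R) (f g h : {linear U -> V}) :
  (forall x, h x = f x + g x) -> forall x, fmor F h x = fmor F f x + fmor F g x.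
Proof.
move=> hE x.
pose W : lmodType R := (V * V)%type.
have i1L : linear (fun v : V => (v, 0) : W).
  by move=> a u v; congr pair; rewrite /= scaler0 addr0.
have i2L : linear (fun v : V => (0, v) : W).
  by move=> a u v; congr pair; rewrite /= scaler0 addr0.
have sL : linear (fun w : W => w.1 + w.2).
  by move=> a u v; rewrite /= scalerDr addrACA.
have fgL : linear (fun u => (f u, g u) : W).
  by move=> a u v; congr pair; rewrite /= linearP.
pose p1 : {linear W -> V} := fst; pose p2 : {linear W -> V} := snd.
pose i1 := pack_linear i1L; pose i2 := pack_linear i2L.
pose s := pack_linear sL; pose fg := pack_linear fgL.
have comp (U1 U2 U3 : lmodType R) (k : {linear U2 -> U3}) (l : {linear U1 -> U2})
    (m : {linear U1 -> U3}) y : (forall y, k (l y) = m y) ->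
    fmor F k (fmor F l y) = fmor F m y.
  by move=> kl; rewrite fmor_compE; apply: fmor_ext.
have idE (k : {linear V -> V}) y : k =1 id -> fmor F k y = y.
  by move=> kE; rewrite (fmor_ext (g := idfun) kE) fmor_id.
have zE (k : {linear V -> V}) y : k =1 (fun=> 0) -> fmor F k y = 0.
  by move=> kE; apply: fmor_zero.
have fgE : fmor F fg x = fmor F i1 (fmor F f x) + fmor F i2 (fmor F g x).
  pose p (b : bool) := if b then p1 else p2.
  apply: (@fmor_jointly_injective bool W (fun=> V) p) => [u v uv|[]].
  - by case: u v uv => [u1 u2] [v1 v2] uv; congr pair; [have := uv true | have := uv false].
  - rewrite linearD /= (comp _ _ _ p1 fg f) // !(fmor_compE p1) /=.
    by rewrite idE // zE // addr0.
  rewrite linearD /= (comp _ _ _ p2 fg g) // !(fmor_compE p2) /=.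
  by rewrite zE // idE // add0r.
rewrite -(comp _ _ _ s fg h) => [|y]; last by rewrite /= hE.
rewrite fgE linearD !(fmor_compE s) /=.
by rewrite !idE // => y; rewrite /= ?addr0 ?add0r.
Qed.

Lemma fmor_sum (U V : lmodType R) (I : Type) (r : seq I) (f : I -> {linear U -> V})
    (h : {linear U -> V}) : (forall x, h x = \sum_(i <- r) f i x) ->
  forall x, fmor F h x = \sum_(i <- r) fmor F (f i) x.
Proof.
elim: r h => [|i r IH] h hE x.
  by rewrite big_nil; apply: fmor_zero => u; rewrite hE big_nil.
have sL : linear (fun x => \sum_(j <- r) f j x).
  by move=> a u v; rewrite scaler_sumr -big_split; apply: eq_bigr => j _ /=; rewrite linearP.
rewrite big_cons (@fmor_add _ _ (f i) (pack_linear sL)) => [|u]; last first.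
  by rewrite hE big_cons.
by rewrite (IH (pack_linear sL)).
Qed.

(* The trace ideal N of G(S) in R is all of R, because F maps the inclusion of
   N in R to an isomorphism. *)
Lemma generator_trace : exists l : seq ({linear G S^o -> R^o} * G S^o),
  1 = \sum_(hq <- l) hq.1 hq.2.
Proof.
pose N : set R^o := fun x => exists l : seq ({linear G S^o -> R^o} * G S^o),
  x = \sum_(hq <- l) hq.1 hq.2.
have sN : submodule N.
  split; first by exists [::]; rewrite big_nil.
  move=> a x y [l ->] [l' ->]; exists ([seq (hq.1, a *: hq.2) | hq <- l] ++ l').
  rewrite big_cat big_map scaler_sumr; congr (_ + _).
  by apply: eq_bigr => hq _; rewrite linearZ.
pose i := submodule_incl sN.
have Fi_inj x y : fmor F i x = fmor F i y -> x = y.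
  move=> xy; apply: (@fmor_jointly_injective unit _ (fun=> R^o) (fun=> i)) => // u v uv.
  by apply: val_inj; apply: (uv tt).
have [eps' epsK epsK'] := eps_bij S^o.
(* The map from S to [F R] sending 1 to [y] comes from some [h] on [G S], whose values lie in the
   trace [N]; lifting [h] to [N] gives the preimage. *)
have /choice[j' jE] : forall y, exists x, fmor F i x = y.
  move=> y; have [h hE] := fmor_lift (pack_linear (element_map_linear y)).
  have [|g gE] := submodule_lift sN (f := h).
    by move=> v; exists [:: (h, v)]; rewrite big_seq1.
  exists (fmor F g (eps' 1)); rewrite fmor_compE (fmor_ext (g := h)) => [|v]; last exact: gE.
  by rewrite hE epsK' /pack_linear /= /element_map scale1r.
have jL : linear j' by move=> a x y; apply: Fi_inj; rewrite linearP !jE.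
have [j jF] := fmor_full (pack_linear jL).
have ij : i \o j =1 idfun.
  apply: (fmor_faithful (f := i \o j) (g := idfun)) => x.
  by rewrite -fmor_compE jF jE fmor_id.
have N1 := submodule_valP (j 1); have i1 : val (j 1) = 1 := ij 1.
by rewrite i1 in N1.
Qed.

(** By [generator_trace] the identity of R is a sum of maps factoring through [G S]. Applying F, the
    identity of [F R] becomes a sum of maps factoring through [F (G S)], a copy of S. *)
Lemma equivalence_dual_basis :
  exists n (f : 'I_n -> {linear F R^o -> S^o}) (p : 'I_n -> F R^o),
    forall x, x = \sum_i (f i x : S) *: p i.
Proof.
have [l lE] := generator_trace; have [eps' epsK epsK'] := eps_bij S^o.
pose rho (q : G S^o) : {linear R^o -> G S^o} := pack_linear (element_map_linear q).
pose q (i : 'I_(size l)) := tnth (in_tuple l) i.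
exists (size l), (fun i => eps S^o \o fmor F (rho (q i).2) : {linear F R^o -> S^o}),
  (fun i => fmor F (q i).1 (eps' 1)) => x.
have xE : x = \sum_(hq <- l) fmor F (hq.1 \o rho hq.2 : {linear R^o -> R^o}) x.
  rewrite -[LHS](fmor_id (m := F)); apply: fmor_sum => a.
  rewrite -[LHS](mulr1 a) lE mulr_sumr; apply: eq_bigr => hq _.
  by rewrite /rho /pack_linear /= /element_map linearZ.
rewrite [LHS]xE big_tnth; apply: eq_bigr => i _; rewrite -fmor_compE -linearZ.
congr (fmor F _ _).
apply: (bij_inj (eps_bij S^o)); rewrite linearZ epsK'.
by rewrite [RHS]mulr1.
Qed.

(** R is the opposite endomorphism ring of the left module R, via right multiplications, and F is
    fully faithful. Coordinates are row vectors, so matrices compose in the order of the product in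
    R. *)
Theorem equivalence_corner : exists n (phi : R -> 'M[S]_n),
  [/\ forall x y, phi (x + y) = phi x + phi y,
      forall x y, phi (x * y) = phi x *m phi y,
      injective phi &
      forall M, exists x, phi x = phi 1 *m M *m phi 1].
Proof.
have [n [f [p fp]]] := equivalence_dual_basis.
pose rho (x : R^o) : {linear R^o -> R^o} := pack_linear (element_map_linear x).
pose phi (x : R) : 'M[S]_n := \matrix_(i, j) (f j (fmor F (rho x) (p i)) : S).
exists n, phi; split=> [x y|x y|x y xy|M].
- apply/matrixP => i j; rewrite !mxE.
  rewrite (@fmor_add _ _ (rho x) (rho y)) ?linearD // => z.
  exact: (mulrDr (z : R) x y).
- apply/matrixP => i j; rewrite !mxE.
  have -> : fmor F (rho (x * y)) (p i) = fmor F (rho y) (fmor F (rho x) (p i)).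
    rewrite fmor_compE; apply: fmor_ext => z; exact: (mulrA z x y).
  rewrite {1}[fmor F (rho x) (p i)]fp !linear_sum; apply: eq_bigr => k _.
  by rewrite !linearZ !mxE.
- have : rho x =1 rho y.
    apply: fmor_faithful => z; rewrite [z]fp !linear_sum; apply: eq_bigr => i _.
    rewrite !linearZ; congr (_ *: _); rewrite [LHS]fp [RHS]fp.
    by apply: eq_bigr => j _; have /matrixP/(_ i j) := xy; rewrite !mxE => ->.
  by move=> /(_ 1); rewrite /rho /pack_linear /= /element_map !scale1r.
have phi1 i j : phi 1 i j = f j (p i).
  rewrite mxE; congr (f j _); rewrite -[RHS]fmor_id; apply: fmor_ext => z.
  exact: mulr1.
(* The endomorphism of [F R] with matrix [phi 1 *m M *m phi 1]; by fullness it comes from right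
   multiplication by [h' 1]. *)
pose h (x : F R^o) := \sum_i \sum_j ((f i x : S) * M i j) *: p j.
have hL : linear h.
  move=> a x y; rewrite /h scaler_sumr -big_split; apply: eq_bigr => i _ /=.
  rewrite scaler_sumr -big_split; apply: eq_bigr => j _ /=.
  by rewrite linearP scalerA mulrA -scalerDl -mulrDl.
have [h' hE] := fmor_full (pack_linear hL).
exists (h' 1); apply/matrixP => k l; rewrite mxE.
have -> : fmor F (rho (h' 1)) (p k) = h (p k).
  rewrite -[RHS]/(pack_linear hL (p k)) -hE; apply: fmor_ext => z.
  by rewrite /rho /pack_linear /= /element_map -linearZ; congr (h' _); apply: mulr1.
rewrite /h linear_sum mxE; under eq_bigr do rewrite linear_sum.
rewrite exchange_big; apply: eq_bigr => j _; rewrite mxE mulr_suml.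
by apply: eq_bigr => i _; rewrite linearZ !phi1.
Qed.

End Equivalence.

Theorem mainTheorem2 (K : fieldType) (A : falgType K)
  (hA : special_multiserial A) : multiserial_algebra A.
Proof.
case: hA => Q [I [admI condM [B [pi [pi_surj pi_ker [F [G [FG GF]]]]]]]].
have [eta [eta_bij eta_nat]] := FG; have [eps [eps_bij eps_nat]] := GF.
have [n [phi [phiD phiM phi_inj phi_surj]]] :=
  equivalence_corner eta_bij eta_nat eps_bij eps_nat.
exact: (corner_multiserial admI condM pi_surj pi_ker phiD phiM phi_inj erefl phi_surj).
Qed.
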